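(* Let $I\subseteq\mathbb{R}$ be either $(a,b)$, $(a,b]$, $[a,b)$ or $[a,b]$, where $-\infty\le a<b\le\infty$, let $\lambda_1,\lambda_2: I\to\mathbb{C}$ be continuous, and let $t_0\in(a,b)$. Consider the system $$\bm{x}'=A(t)\bm{x},\qquad A(t)=\begin{pmatrix}\lambda_1(t)&0\\0&\lambda_2(t)\end{pmatrix},\qquad (\ast)$$ and its fundamental matrix $X(t)=\begin{pmatrix}e^{\int_{t_0}^t\lambda_1(s)ds}&0\\0&e^{\int_{t_0}^t\lambda_2(s)ds}\end{pmatrix}$, $t\in I$. Then the following hold. (i) Suppose that $\kappa_{11}(t):=\int_t^b e^{-\int_t^s\min\{\Re(\lambda_1(\tau)),\Re(\lambda_2(\tau))\}d\tau}ds$ exists for all $t\in I$ and $\sup_{t\in I}\kappa_{11}(t)<\infty$. Then $(\ast)$ is Ulam stable on $I$, with an Ulam constant $K_{11}:=\sup_{t\in I}\kappa_{11}(t)$. Furthermore, if in addition $\lim_{t\to b-0}\int_{t_0}^t\min\{\Re(\lambda_1(s)),\Re(\lambda_2(s))\}ds=\infty$, then for any $\varepsilon>0$ and any continuously differentiable $\bm{\phi}: I\to\mathbb{C}^2$ satisfying $\sup_{t\in I}\|\bm{\phi}'(t)-A(t)\bm{\phi}(t)\|_\infty\le\varepsilon$, the limit $\lim_{t\to b-0}X^{-1}(t)\bm{\phi}(t)$ is a well-defined constant vector, and $\bm{x}(t)=X(t)\left(\lim_{s\to b-0}X^{-1}(s)\bm{\phi}(s)\right)$ is the unique solution of $(\ast)$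 such that $\sup_{t\in I}\|\bm{\phi}(t)-\bm{x}(t)\|_\infty\le K_{11}\varepsilon$. (ii) Suppose that $\kappa_{12}(t):=\int_a^t e^{\int_s^t\max\{\Re(\lambda_1(\tau)),\Re(\lambda_2(\tau))\}d\tau}ds$ exists for all $t\in I$ and $\sup_{t\in I}\kappa_{12}(t)<\infty$. Then $(\ast)$ is Ulam stable on $I$, with an Ulam constant $K_{12}:=\sup_{t\in I}\kappa_{12}(t)$. Furthermore, if in addition $\lim_{t\to a+0}\int_t^{t_0}\min\{-\Re(\lambda_1(s)),-\Re(\lambda_2(s))\}ds=\infty$, then for any $\varepsilon>0$ and any continuously differentiable $\bm{\phi}: I\to\mathbb{C}^2$ satisfying $\sup_{t\in I}\|\bm{\phi}'(t)-A(t)\bm{\phi}(t)\|_\infty\le\varepsilon$, the limit $\lim_{t\to a+0}X^{-1}(t)\bm{\phi}(t)$ is a well-defined constant vector, and $\bm{x}(t)=X(t)\left(\lim_{s\to a+0}X^{-1}(s)\bm{\phi}(s)\right)$ is the unique solution of $(\ast)$ such that $\sup_{t\in I}\|\bm{\phi}(t)-\bm{x}(t)\|_\infty\le K_{12}\varepsilon$. (iii) Suppose that $\kappa_{13}(t):=\max\left\{\int_t^b e^{-\int_t^s\Re(\lambda_1(\tau))d\tau}ds,\ \int_a^t e^{\int_s^t\Re(\lambda_2(\tau))d\tau}ds\right\}$ exists for all $t\in I$ and $\sup_{t\in I}\kappa_{13}(t)<\infty$. Then $(\ast)$ is Ulam stable on $I$, with an Ulam constant $K_{13}:=\sup_{t\in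 I}\kappa_{13}(t)$. Furthermore, if in addition $\lim_{t\to b-0}\int_{t_0}^t\Re(\lambda_1(s))ds=\lim_{t\to a+0}\int_{t_0}^t\Re(\lambda_2(s))ds=\infty$, then for any $\varepsilon>0$ and any continuously differentiable $\bm{\phi}=(\phi_1,\phi_2)^T: I\to\mathbb{C}^2$ satisfying $\sup_{t\in I}\|\bm{\phi}'(t)-A(t)\bm{\phi}(t)\|_\infty\le\varepsilon$, the vector $$\bm{c}:=\begin{pmatrix}\lim_{t\to b-0}\phi_1(t)e^{-\int_{t_0}^t\lambda_1(s)ds}\\ \lim_{t\to a+0}\phi_2(t)e^{\int_t^{t_0}\lambda_2(s)ds}\end{pmatrix}$$ is a well-defined constant vector, and $\bm{x}(t)=X(t)\bm{c}$ is the unique solution of $(\ast)$ such that $\sup_{t\in I}\|\bm{\phi}(t)-\bm{x}(t)\|_\infty\le K_{13}\varepsilon$.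
   Context: $\|(v_1,v_2)^T\|_\infty=\max\{|v_1|,|v_2|\}$ on $\mathbb{C}^2$, and $\Re(z)$ is the real part of $z$. The integrals defining the $\kappa$'s are possibly improper, and ''exists'' means that they converge. For continuous $A: I\to\mathbb{C}^{2\times2}$, the equation $\bm{x}'=A(t)\bm{x}$ is called Ulam stable on $I$ if there is a constant $K>0$ such that: for every $\varepsilon>0$ and every continuously differentiable $\bm{\phi}: I\to\mathbb{C}^2$ with $\sup_{t\in I}\|\bm{\phi}'(t)-A(t)\bm{\phi}(t)\|_\infty\le\varepsilon$, there exists a solution $\bm{x}: I\to\mathbb{C}^2$ of the equation with $\sup_{t\in I}\|\bm{\phi}(t)-\bm{x}(t)\|_\infty\le K\varepsilon$. Any such $K$ is called an Ulam constant for the equation on $I$. *)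

(* Defs.v *)
From Stdlib Require Import Reals.
From Coquelicot Require Import Coquelicot.

Open Scope R_scope.

(* [I] is one of (a,b), (a,b], [a,b), [a,b], as a set of real numbers.  When
   an end is infinite, including it or not gives the same set. *)
Definition interval_with_ends (a b : Rbar) (I : R -> Prop) : Prop :=
  (forall t : R, I t <-> Rbar_lt a t /\ Rbar_lt t b) \/
  (forall t : R, I t <-> Rbar_lt a t /\ Rbar_le t b) \/
  (forall t : R, I t <-> Rbar_le a t /\ Rbar_lt t b) \/
  (forall t : R, I t <-> Rbar_le a t /\ Rbar_le t b).

(* t -> b-0 and t -> a+0; Coquelicot's [at_left] and [at_right] only accept
   finite points. *)
Definition Rbar_at_left (b : Rbar) : (R -> Prop) -> Prop :=
  within (fun t => Rbar_lt t b) (Rbar_locally b).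

Definition Rbar_at_right (a : Rbar) : (R -> Prop) -> Prop :=
  within (fun t => Rbar_lt a t) (Rbar_locally a).

Definition sup_on (I : R -> Prop) (f : R -> R) : Rbar :=
  Lub_Rbar (fun y => exists t, I t /\ y = f t).

Definition Cexp (z : C) : C :=
  (exp (Re z) * cos (Im z), exp (Re z) * sin (Im z)).

(* C^2 as a normed module over the reals.  The norm carried by this structure
   is Euclidean and is used only through the topology and the derivative; the
   norm of the Ulam estimates is [norm_inf]. *)
Definition C2 : NormedModule R_AbsRing :=
  prod_NormedModule R_AbsRing C_R_NormedModule C_R_NormedModule.

Definition norm_inf (v : C2) : R := Rmax (Cmod (fst v)) (Cmod (snd v)).

Definition M2 : Type := @matrix C 2 2.

Definition entry (M : M2) (i j : nat) : C := coeff_mat (RtoC 0) M i j.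

Definition mat2 (a b c d : C) : M2 :=
  mk_matrix 2 2 (fun i j =>
    match i, j with
    | O, O => a
    | O, _ => b
    | _, O => c
    | _, _ => d
    end).

Definition diag2 (a d : C) : M2 := mat2 a (RtoC 0) (RtoC 0) d.

Definition mulv (M : M2) (v : C2) : C2 :=
  (Cplus (Cmult (entry M 0 0) (fst v)) (Cmult (entry M 0 1) (snd v)),
   Cplus (Cmult (entry M 1 0) (fst v)) (Cmult (entry M 1 1) (snd v))).

Definition det2 (M : M2) : C :=
  Cminus (Cmult (entry M 0 0) (entry M 1 1))
         (Cmult (entry M 0 1) (entry M 1 0)).

Definition inv2 (M : M2) : M2 :=
  mat2 (Cdiv (entry M 1 1) (det2 M)) (Cdiv (Copp (entry M 0 1)) (det2 M))
       (Cdiv (Copp (entry M 1 0)) (det2 M)) (Cdiv (entry M 0 0) (det2 M)).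

Lemma inv2_correct (M : M2) : det2 M <> RtoC 0 ->
  Mmult (T := C_Ring) M (inv2 M) = Mone (T := C_Ring) /\
  Mmult (T := C_Ring) (inv2 M) M = Mone (T := C_Ring).
Proof.
destruct M as [[a [b []]] [[c [d []]] []]].
unfold inv2, det2, entry, mat2, Mmult, Mone, mk_matrix; simpl.
intros H.
rewrite !sum_Sn, !sum_O.
unfold plus, mult, one, zero; simpl.
split; repeat (apply f_equal2; try reflexivity);
  unfold coeff_mat; simpl; field; exact H.
Qed.

(* Derivative at [t] relative to [I]: two-sided at interior points, one-sided
   at an end belonging to [I]. *)
Definition is_derive_in (I : R -> Prop) (f : R -> C2) (t : R) (l : C2) : Prop :=
  filterdiff f (within I (locally t)) (fun h : R => scal h l).

Definition is_solution (A : R -> M2) (I : R -> Prop) (x : R -> C2) : Prop :=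
  forall t, I t -> is_derive_in I x t (mulv (A t) (x t)).

(* [phi] is continuously differentiable on [I] and the supremum over [I] of
   the norm of phi' - A phi is at most [eps]. *)
Definition is_approx_solution
    (A : R -> M2) (I : R -> Prop) (eps : R) (phi : R -> C2) : Prop :=
  exists dphi : R -> C2,
    (forall t, I t -> is_derive_in I phi t (dphi t)) /\
    continuous_on I dphi /\
    Rbar_le
      (sup_on I (fun t => norm_inf (minus (dphi t) (mulv (A t) (phi t))))) eps.

Definition within_dist (I : R -> Prop) (phi x : R -> C2) (r : R) : Prop :=
  Rbar_le (sup_on I (fun t => norm_inf (minus (phi t) (x t)))) r.

Definition is_Ulam_constant (A : R -> M2) (I : R -> Prop) (K : R) : Prop :=
  0 < K /\
  forall eps : R, 0 < eps ->
  forall phi : R -> C2, is_approx_solution A I eps phi ->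
  exists x : R -> C2, is_solution A I x /\ within_dist I phi x (K * eps).

Definition Ulam_stable (A : R -> M2) (I : R -> Prop) : Prop :=
  exists K : R, is_Ulam_constant A I K.

(* Functions on [I] are represented by total functions, so uniqueness means
   agreement on [I]. *)
Definition is_unique_solution_within
    (A : R -> M2) (I : R -> Prop) (phi : R -> C2) (r : R) (x : R -> C2) : Prop :=
  is_solution A I x /\ within_dist I phi x r /\
  forall y : R -> C2, is_solution A I y -> within_dist I phi y r ->
    forall t, I t -> y t = x t.

Definition CRInt (f : R -> C) (s t : R) : C :=
  RInt (V := C_R_CompleteNormedModule) f s t.

Definition Adiag (l1 l2 : R -> C) (t : R) : M2 := diag2 (l1 t) (l2 t).

Definition Xdiag (l1 l2 : R -> C) (t0 t : R) : M2 :=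
  diag2 (Cexp (CRInt l1 t0 t)) (Cexp (CRInt l2 t0 t)).

(* For a real function [m]: the integrals over s from t to b of
   exp (- int_t^s m), and over s from a to t of exp (int_s^t m). *)
Definition forward_integrand (m : R -> R) (t s : R) : R := exp (- RInt m t s).

Definition backward_integrand (m : R -> R) (t s : R) : R := exp (RInt m s t).

Definition ex_forward (b : Rbar) (m : R -> R) (t : R) : Prop :=
  ex_RInt_gen (forward_integrand m t) (at_point t) (Rbar_at_left b).

Definition forward (b : Rbar) (m : R -> R) (t : R) : R :=
  RInt_gen (forward_integrand m t) (at_point t) (Rbar_at_left b).

Definition ex_backward (a : Rbar) (m : R -> R) (t : R) : Prop :=
  ex_RInt_gen (backward_integrand m t) (Rbar_at_right a) (at_point t).

Definition backward (a : Rbar) (m : R -> R) (t : R) : R :=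
  RInt_gen (backward_integrand m t) (Rbar_at_right a) (at_point t).

Definition min_Re (l1 l2 : R -> C) (t : R) : R := Rmin (Re (l1 t)) (Re (l2 t)).

Definition max_Re (l1 l2 : R -> C) (t : R) : R := Rmax (Re (l1 t)) (Re (l2 t)).

Definition kappa11 (b : Rbar) (l1 l2 : R -> C) (t : R) : R :=
  forward b (min_Re l1 l2) t.

Definition kappa12 (a : Rbar) (l1 l2 : R -> C) (t : R) : R :=
  backward a (max_Re l1 l2) t.

Definition kappa13 (a b : Rbar) (l1 l2 : R -> C) (t : R) : R :=
  Rmax (forward b (fun s => Re (l1 s)) t) (backward a (fun s => Re (l2 s)) t).

(* Main.v *)
(* Each component can be treated separately.  If |phi' - l phi| <= eps and
   g(t) = phi(t) exp (- int_{t0}^t l), then |g'| <= eps exp (- int_{t0}^t Re l),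
   so convergence of the integral of the weight towards one end of the interval
   makes g Cauchy there, with a limit c.  Letting s tend to that end in the bound
   for |exp (int_{t0}^t l) (g(s) - g(t))| gives
   |exp (int_{t0}^t l) c - phi(t)| <= eps kappa(t), first in the interior and then
   on all of I by continuity.  If int_{t0}^t Re l tends to infinity at that end,
   two multiples of exp (int_{t0}^t l) at bounded distance coincide.  Replacing
   Re l by a bound m on the correct side handles the minimum and maximum in
   (i) and (ii). *)

Require Import Defs.
From Stdlib Require Import Reals Lra Classical.
From Coquelicot Require Import Coquelicot.

Open Scope R_scope.

(** * Complex-valued functions of a real variable *)

(** Both ends are handled by one argument because every integral is oriented from t. The weight
    exp(- int_t^s m) is [forward_integrand m t] on either side of t; towards a its oriented integral
    converges to minus the backward kappa, and an absolute value removes the sign. In this form the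
    comparison is a single inequality, int_t^s m <= int_t^s Re l, met by the minimum for s >= t and
    by the maximum for s <= t. The scalar argument is thus carried out at an abstract end, chosen
    separately for each component.

    The weight is anchored at t and not at t0: this is what produces exactly kappa(t) as the bound.

    The obstacle is that functions on [I] are total, with arbitrary values outside [I], so at an end
    of [I] derivatives are only one-sided. The estimates are therefore proved on the open interior.
    The ends enter through continuity, and through the verification that X c solves the system
    there.

    An Ulam constant must also be positive, which is why strict positivity of the improper integrals
    is proved. *)

Lemma norm_Cmod (z : C) : norm (V := C_R_NormedModule) z = Cmod z.
Proof.
unfold Cmod; rewrite <- (pow2_abs (fst z)), <- (pow2_abs (snd z)).
reflexivity.
Qed.

Lemma filterdiff_pair {K : AbsRing} {U V W : NormedModule K}
    {F : (U -> Prop) -> Prop} {FF : Filter F}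
    (f : U -> V) (g : U -> W) (lf : U -> V) (lg : U -> W) :
  filterdiff f F lf -> filterdiff g F lg ->
  filterdiff (V := prod_NormedModule K V W)
    (fun t => (f t, g t)) F (fun t => (lf t, lg t)).
Proof.
intros Hf Hg.
apply (filterdiff_comp_2 (W := prod_NormedModule K V W) f g
  (fun v w => (v, w)) lf lg (fun v w => (v, w)) Hf Hg).
apply filterdiff_ext with (fun t => t).
{ now intros []. }
apply filterdiff_ext_lin with (fun t => t).
{ apply filterdiff_id. }
now intros [].
Qed.

Lemma filterdiff_fst_snd {K : AbsRing} {U V W : NormedModule K}
    {F : (U -> Prop) -> Prop} {FF : Filter F}
    (f lf : U -> prod_NormedModule K V W) :
  filterdiff f F lf ->
  filterdiff (fun t => fst (f t)) F (fun t => fst (lf t)) /\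
  filterdiff (fun t => snd (f t)) F (fun t => snd (lf t)).
Proof.
intros Hf; split.
- apply (filterdiff_comp (F := F) f (fst : prod_NormedModule K V W -> V) lf fst Hf).
  apply filterdiff_linear, is_linear_fst.
- apply (filterdiff_comp (F := F) f (snd : prod_NormedModule K V W -> W) lf snd Hf).
  apply filterdiff_linear, is_linear_snd.
Qed.

(** Lets products and exponentials be differentiated coordinatewise by the real rules. *)
Lemma is_derive_C (f : R -> C) (t : R) (l : C) :
  is_derive (V := C_R_NormedModule) f t l <->
  is_derive (fun s => Re (f s)) t (Re l) /\
  is_derive (fun s => Im (f s)) t (Im l).
Proof.
split.
- intros H.
  exact (filterdiff_fst_snd (F := locally t) (V := R_NormedModule)
    (W := R_NormedModule) f _ H).
- intros [H1 H2].
  apply filterdiff_ext with (fun s => (Re (f s), Im (f s))).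
  { intros s; now destruct (f s). }
  exact (filterdiff_pair (F := locally t) (V := R_NormedModule)
    (W := R_NormedModule) _ _ _ _ H1 H2).
Qed.

Lemma is_derive_Cmult (f g : R -> C) (t : R) (df dg : C) :
  is_derive (V := C_R_NormedModule) f t df ->
  is_derive (V := C_R_NormedModule) g t dg ->
  is_derive (V := C_R_NormedModule) (fun s => Cmult (f s) (g s)) t
    (Cplus (Cmult df (g t)) (Cmult (f t) dg)).
Proof.
rewrite !is_derive_C; intros [f1 f2] [g1 g2]; split; simpl.
- evar_last.
  { apply @is_derive_minus; apply Derive.is_derive_mult; eassumption. }
  unfold minus, plus, opp, Re, Im; simpl; ring.
- evar_last.
  { apply @is_derive_plus; apply Derive.is_derive_mult; eassumption. }
  unfold minus, plus, opp, Re, Im; simpl; ring.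
Qed.

Lemma is_derive_Cexp (f : R -> C) (t : R) (df : C) :
  is_derive (V := C_R_NormedModule) f t df ->
  is_derive (V := C_R_NormedModule) (fun s => Cexp (f s)) t
    (Cmult df (Cexp (f t))).
Proof.
rewrite !is_derive_C; intros [f1 f2]; split; simpl.
- evar_last.
  { apply Derive.is_derive_mult.
    - apply @is_derive_comp; [apply is_derive_exp | exact f1].
    - apply @is_derive_comp; [apply is_derive_cos | exact f2]. }
  unfold scal, mult, Re, Im; simpl; unfold mult; simpl; ring.
- evar_last.
  { apply Derive.is_derive_mult.
    - apply @is_derive_comp; [apply is_derive_exp | exact f1].
    - apply @is_derive_comp; [apply is_derive_sin | exact f2]. }
  unfold scal, mult, Re, Im; simpl; unfold mult; simpl; ring.
Qed.

Lemma Cexp_plus (z w : C) : Cexp (Cplus z w) = Cmult (Cexp z) (Cexp w).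
Proof.
unfold Cexp, Cmult, Re, Im; simpl.
rewrite exp_plus, cos_plus, sin_plus; apply f_equal2; ring.
Qed.

Lemma Cexp_opp_l (z : C) : Cmult (Cexp (Copp z)) (Cexp z) = RtoC 1.
Proof.
rewrite <- Cexp_plus, Cplus_comm, Cplus_opp_r.
unfold Cexp, RtoC; simpl; rewrite exp_0, cos_0, sin_0; apply f_equal2; ring.
Qed.

Lemma Cmod_Cexp (z : C) : Cmod (Cexp z) = exp (Re z).
Proof.
transitivity (sqrt (Rsqr (exp (Re z)))).
2: { apply sqrt_Rsqr; left; apply exp_pos. }
unfold Cmod, Cexp; simpl; apply f_equal.
transitivity (Rsqr (exp (Re z)) * (Rsqr (sin (Im z)) + Rsqr (cos (Im z)))).
{ unfold Rsqr; ring. }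
rewrite sin2_cos2; ring.
Qed.

Lemma Cexp_neq_0 (z : C) : Cexp z <> RtoC 0.
Proof.
intros H; generalize (Cmod_Cexp z); rewrite H, Cmod_0.
generalize (exp_pos (Re z)); lra.
Qed.

Lemma filterlim_C_components {T : Type} {F : (T -> Prop) -> Prop} {FF : Filter F}
    (f : T -> C) (z : C) :
  filterlim f F (locally (T := C_UniformSpace) z) ->
  filterlim (fun s => Re (f s)) F (locally (Re z)) /\
  filterlim (fun s => Im (f s)) F (locally (Im z)).
Proof.
intros H; destruct z as [x y]; split.
- exact (filterlim_comp _ _ _ f (fst : C_UniformSpace -> R_UniformSpace)
    _ _ _ H (continuous_fst x y)).
- exact (filterlim_comp _ _ _ f (snd : C_UniformSpace -> R_UniformSpace)
    _ _ _ H (continuous_snd x y)).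
Qed.

(** * Continuous functions on a convex set *)

Definition is_convex (I : R -> Prop) : Prop :=
  forall u v w : R, I u -> I v -> u <= w <= v -> I w.

Lemma is_convex_minmax (I : R -> Prop) (s t r : R) :
  is_convex I -> I s -> I t -> Rmin s t <= r <= Rmax s t -> I r.
Proof.
intros hc Hs Ht; unfold Rmin, Rmax.
destruct (Rle_dec s t); intros Hr; [apply (hc s t) | apply (hc t s)]; auto.
Qed.

(** The nearest-point projection onto [u, v] when u <= v. Precomposing with it freezes a function
    beyond [u, v], so that continuity relative to a set containing [u, v] becomes continuity on the
    whole line. *)
Definition clamp (u v x : R) : R := Rmax u (Rmin v x).

Lemma clamp_bounds (u v x : R) : u <= v -> u <= clamp u v x <= v.
Proof.
intros H; unfold clamp, Rmax, Rmin.
destruct (Rle_dec v x); destruct (Rle_dec u _); lra.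
Qed.

Lemma clamp_id (u v x : R) : u <= x <= v -> clamp u v x = x.
Proof.
intros H; unfold clamp; rewrite Rmin_right, Rmax_right; lra.
Qed.

Lemma clamp_contract (u v x y : R) : u <= v ->
  Rabs (clamp u v y - clamp u v x) <= Rabs (y - x).
Proof.
intros H; unfold clamp, Rmax, Rmin.
destruct (Rle_dec v x); destruct (Rle_dec u _);
destruct (Rle_dec v y); destruct (Rle_dec u _);
unfold Rabs; repeat destruct (Rcase_abs _); lra.
Qed.

(** [clamp u v] is 1-Lipschitz with values in [I], so near [x] it only visits points of [I] close to
    [clamp u v x], where continuity relative to [I] applies. *)
Lemma continuous_clamp_extension {U : UniformSpace} (I : R -> Prop)
    (f : R -> U) (u v : R) :
  is_convex I -> continuous_on I f -> I u -> I v -> u <= v ->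
  forall x, continuous (fun x => f (clamp u v x)) x.
Proof.
intros hc hf Hu Hv Huv x.
assert (Hin : forall y, I (clamp u v y)).
{ intros y; eapply hc; [exact Hu | exact Hv | now apply clamp_bounds]. }
apply (filterlim_comp _ _ _ (clamp u v) f _
  (within I (locally (clamp u v x)))).
2: now apply hf.
intros P [d Hd]; exists d; intros y Hy.
apply Hd; [| apply Hin].
apply Rle_lt_trans with (2 := Hy).
now apply clamp_contract.
Qed.

Lemma ex_RInt_continuous_on {V : CompleteNormedModule R_AbsRing}
    (I : R -> Prop) (f : R -> V) (s t : R) :
  is_convex I -> continuous_on I f -> I s -> I t -> ex_RInt f s t.
Proof.
intros hc hf Hs Ht.
assert (Hm : I (Rmin s t) /\ I (Rmax s t)).
{ split; apply (is_convex_minmax I s t _ hc Hs Ht);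
    split; try apply Rle_refl; apply Rminmax. }
apply ex_RInt_ext with (fun x => f (clamp (Rmin s t) (Rmax s t) x)).
{ intros x Hx; rewrite clamp_id; [reflexivity | lra]. }
apply @ex_RInt_continuous; intros x _.
now apply continuous_clamp_extension with I; try apply Hm; try apply Rminmax.
Qed.

(* At an end of [I] the integrand may jump, as a total function; freezing it
   beyond a compact part of [I] gives a primitive that is differentiable on
   both sides. *)
Lemma local_primitive {V : CompleteNormedModule R_AbsRing}
    (I : R -> Prop) (f : R -> V) (t0 t : R) :
  is_convex I -> continuous_on I f -> I t0 -> I t ->
  exists L : R -> V, is_derive L t (f t) /\
    locally t (fun s => I s -> RInt f t0 s = L s).
Proof.
intros hc hf H0 Ht.
(* The clamping interval [u, v] has to contain t0 and all points of [I] near t. If [I] has a point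
   above t, that point, raised to t0 if necessary, serves as v; otherwise v = t, since nothing of
   [I] lies above. The choice of u is symmetric. *)
assert (Hv : exists v, I v /\ t <= v /\ t0 <= v /\
  locally t (fun s => I s -> s <= v)).
{ destruct (classic (exists s, I s /\ t < s)) as [[s [Hs Hts]] | Hn].
  - exists (Rmax s t0); repeat split.
    + unfold Rmax; now destruct (Rle_dec s t0).
    + apply Rle_trans with s; [lra | apply Rmax_l].
    + apply Rmax_r.
    + apply filter_imp with (fun r => r < s).
      { intros r Hr _; apply Rle_trans with s; [lra | apply Rmax_l]. }
      now apply open_lt.
  - assert (Hle : forall s, I s -> s <= t).
    { intros s Hs; apply Rnot_lt_le; intros Hts; apply Hn; now exists s. }
    exists t; repeat split; auto; try lra.
    now apply filter_forall. }
assert (Hu : exists u, I u /\ u <= t /\ u <= t0 /\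
  locally t (fun s => I s -> u <= s)).
{ destruct (classic (exists s, I s /\ s < t)) as [[s [Hs Hts]] | Hn].
  - exists (Rmin s t0); repeat split.
    + unfold Rmin; now destruct (Rle_dec s t0).
    + apply Rle_trans with s; [apply Rmin_l | lra].
    + apply Rmin_r.
    + apply filter_imp with (fun r => s < r).
      { intros r Hr _; apply Rle_trans with s; [apply Rmin_l | lra]. }
      now apply open_gt.
  - assert (Hle : forall s, I s -> t <= s).
    { intros s Hs; apply Rnot_lt_le; intros Hts; apply Hn; now exists s. }
    exists t; repeat split; auto; try lra.
    now apply filter_forall. }
destruct Hv as (v & Iv & Htv & H0v & Hlv).
destruct Hu as (u & Iu & Hut & Hu0 & Hlu).
assert (Hc : forall x, continuous (fun x => f (clamp u v x)) x).
{ apply continuous_clamp_extension with I; auto; lra. }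
exists (fun s => RInt (fun x => f (clamp u v x)) t0 s); split.
- replace (f t) with (f (clamp u v t)) by (rewrite clamp_id; auto).
  apply (is_derive_RInt (fun x => f (clamp u v x)) _ t0).
  + apply filter_forall; intros s; apply RInt_correct.
    apply @ex_RInt_continuous; intros x _; apply Hc.
  + apply Hc.
- generalize (filter_and _ _ Hlu Hlv); apply filter_imp.
  intros s [H1 H2] Hs; specialize (H1 Hs); specialize (H2 Hs).
  apply RInt_ext; intros x; unfold Rmin, Rmax.
  destruct (Rle_dec t0 s); intros Hx; rewrite clamp_id; auto; lra.
Qed.

Lemma continuous_of_continuous_on {U : UniformSpace} (J : R -> Prop)
    (f : R -> U) (t : R) :
  locally t J -> continuous_on J f -> continuous f t.
Proof.
intros HJ Hf P HP.
assert (H : within J (locally t) (fun x => P (f x))).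
{ exact (Hf t (locally_singleton _ _ HJ) P HP). }
unfold filtermap; generalize (filter_and _ _ HJ H); apply filter_imp.
intros x [H1 H2]; now apply H2.
Qed.

Lemma is_derive_RInt_open {V : CompleteNormedModule R_AbsRing}
    (J : R -> Prop) (f : R -> V) (t0 t : R) :
  is_convex J -> (forall s, J s -> locally s J) -> continuous_on J f ->
  J t0 -> J t -> is_derive (RInt f t0) t (f t).
Proof.
intros hc ho hf H0 Ht.
apply (is_derive_RInt f _ t0).
- generalize (ho t Ht); apply filter_imp; intros s Hs.
  apply RInt_correct; now apply ex_RInt_continuous_on with J.
- apply continuous_of_continuous_on with J; auto.
Qed.

(** * The scalar equation *)

Lemma continuous_Cmult (f g : R -> C) (t : R) :
  continuous (U := C_UniformSpace) f t ->
  continuous (U := C_UniformSpace) g t ->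
  continuous (U := C_UniformSpace) (fun s => Cmult (f s) (g s)) t.
Proof.
intros Hf Hg.
destruct (filterlim_C_components (F := locally t) f _ Hf) as [f1 f2].
destruct (filterlim_C_components (F := locally t) g _ Hg) as [g1 g2].
apply (continuous_comp_2 (V := R_UniformSpace) (W := R_UniformSpace)
  (X := C_UniformSpace)
  (fun s => Re (f s) * Re (g s) - Im (f s) * Im (g s))
  (fun s => Re (f s) * Im (g s) + Im (f s) * Re (g s))
  (fun x y => (x, y))).
- apply @continuous_minus; apply @continuous_mult; assumption.
- apply @continuous_plus; apply @continuous_mult; assumption.
- apply continuous_ext with (fun x => x); [now intros [] | apply continuous_id].
Qed.

Lemma continuous_on_Re (J : R -> Prop) (l : R -> C) :
  continuous_on (U := C_UniformSpace) J l ->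
  continuous_on J (fun s => Re (l s)).
Proof.
intros H t Ht.
now apply (filterlim_C_components (F := within J (locally t)) l), H.
Qed.

Lemma Re_CRInt (J : R -> Prop) (l : R -> C) (s t : R) :
  is_convex J -> continuous_on (U := C_UniformSpace) J l -> J s -> J t ->
  Re (CRInt l s t) = RInt (fun r => Re (l r)) s t.
Proof.
intros hc hl Hs Ht; symmetry; apply is_RInt_unique.
apply (is_RInt_fct_extend_fst (U := R_NormedModule) (V := R_NormedModule) l).
apply (RInt_correct (V := C_R_CompleteNormedModule)).
now apply (ex_RInt_continuous_on (V := C_R_CompleteNormedModule) J).
Qed.

Lemma RInt_Chasles_on (J : R -> Prop) (m : R -> R) (r s t : R) :
  is_convex J -> continuous_on J m -> J r -> J s -> J t ->
  RInt m r t = RInt m r s + RInt m s t.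
Proof.
intros hc hm Hr Hs Ht; symmetry.
apply (RInt_Chasles m r s t); now apply (ex_RInt_continuous_on J).
Qed.

(** Variation of constants: one component of X^{-1} phi, which is constant when phi solves the
    scalar equation. *)
Definition untwist (l : R -> C) (t0 : R) (phi : R -> C) (t : R) : C :=
  Cmult (phi t) (Cexp (Copp (CRInt l t0 t))).

(** Differentiating the exponential contributes - l phi, so only the defect phi' - l phi drives the
    change of [untwist]. *)
Lemma is_derive_untwist (J : R -> Prop) (l phi : R -> C) (dphi : C) (t0 t : R) :
  is_convex J -> (forall s, J s -> locally s J) ->
  continuous_on (U := C_UniformSpace) J l -> J t0 -> J t ->
  is_derive (V := C_R_NormedModule) phi t dphi ->
  is_derive (V := C_R_NormedModule) (untwist l t0 phi) t
    (Cmult (Cminus dphi (Cmult (l t) (phi t))) (Cexp (Copp (CRInt l t0 t)))).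
Proof.
intros hc ho hl H0 Ht Hphi.
evar_last.
- apply is_derive_Cmult; [exact Hphi |].
  apply is_derive_Cexp.
  apply (is_derive_opp (V := C_R_NormedModule) (CRInt l t0)).
  now apply (is_derive_RInt_open (V := C_R_CompleteNormedModule) J).
- change (opp (l t)) with (Copp (l t)).
  change (opp (CRInt l t0 t)) with (Copp (CRInt l t0 t)).
  simpl; ring.
Qed.

Lemma continuous_weight (J : R -> Prop) (m : R -> R) (t s : R) :
  is_convex J -> (forall s, J s -> locally s J) -> continuous_on J m ->
  J t -> J s -> continuous (forward_integrand m t) s.
Proof.
intros hc ho hm Ht Hs.
apply (continuous_comp (fun s => - RInt m t s) exp).
- apply (continuous_opp (V := R_NormedModule) (RInt m t)).
  apply @ex_derive_continuous; exists (m s).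
  now apply (is_derive_RInt_open (V := R_CompleteNormedModule) J).
- apply @ex_derive_continuous; exists (exp (- RInt m t s)); apply is_derive_exp.
Qed.

Lemma ex_RInt_weight (J : R -> Prop) (m : R -> R) (t s s' : R) :
  is_convex J -> (forall s, J s -> locally s J) -> continuous_on J m ->
  J t -> J s -> J s' -> ex_RInt (forward_integrand m t) s s'.
Proof.
intros hc ho hm Ht Hs Hs'.
apply @ex_RInt_continuous; intros r Hr.
apply continuous_weight with J; auto.
now apply (is_convex_minmax J s s').
Qed.

(** The derivative of [untwist] at r has modulus at most eps exp(- int_{t0}^r Re l). Splitting this
    exponent at t pulls out a constant factor and leaves exp(- int_t^r Re l), which is at most the
    integrand of kappa(t); then integrate. *)
Lemma untwist_increment (J : R -> Prop) (l phi dphi : R -> C) (m : R -> R)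
    (eps t0 t s s' : R) :
  is_convex J -> (forall s, J s -> locally s J) ->
  continuous_on (U := C_UniformSpace) J l ->
  continuous_on (U := C_UniformSpace) J dphi -> continuous_on J m ->
  (forall r, J r -> is_derive (V := C_R_NormedModule) phi r (dphi r)) ->
  (forall r, J r -> Cmod (Cminus (dphi r) (Cmult (l r) (phi r))) <= eps) ->
  J t0 -> J t -> J s -> J s' ->
  (forall r, Rmin s s' <= r <= Rmax s s' ->
     RInt m t r <= RInt (fun x => Re (l x)) t r) ->
  Cmod (Cminus (untwist l t0 phi s') (untwist l t0 phi s)) <=
  exp (- RInt (fun x => Re (l x)) t0 t) *
    (eps * Rabs (RInt (forward_integrand m t) s s')).
Proof.
intros hc ho hl hd hm Hphi Heps H0 Ht.
assert (hR := continuous_on_Re J l hl).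
revert s s'.
(* It is enough to treat s <= s': exchanging the two points only changes signs inside [Cmod] and
   [Rabs]. *)
assert (Hle : forall s s', s <= s' -> J s -> J s' ->
  (forall r, Rmin s s' <= r <= Rmax s s' ->
     RInt m t r <= RInt (fun x => Re (l x)) t r) ->
  Cmod (Cminus (untwist l t0 phi s') (untwist l t0 phi s)) <=
  exp (- RInt (fun x => Re (l x)) t0 t) *
    (eps * Rabs (RInt (forward_integrand m t) s s'))).
2: { intros s s' Hs Hs' Hr; destruct (Rle_dec s s') as [H | H].
  - now apply Hle.
  - replace (Cminus (untwist l t0 phi s') (untwist l t0 phi s)) with
      (Copp (Cminus (untwist l t0 phi s) (untwist l t0 phi s'))) by ring.
    rewrite Cmod_opp, <- (opp_RInt_swap (forward_integrand m t) s' s).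
    2: now apply ex_RInt_weight with J.
    change opp with Ropp; rewrite Rabs_Ropp.
    apply Hle; auto; [lra |].
    now rewrite Rmin_comm, Rmax_comm. }
intros s s' Hss Hs Hs' Hr.
assert (HJ : forall r, s <= r <= s' -> J r).
{ intros r Hsr; now apply (hc s s'). }
rewrite Rmin_left, Rmax_right in Hr by lra.
assert (Hw := RInt_correct _ _ _ (ex_RInt_weight J m t s s' hc ho hm Ht Hs Hs')).
rewrite Rabs_pos_eq.
2: { apply RInt_ge_0; auto.
     - now apply ex_RInt_weight with J.
     - intros x _; left; apply exp_pos. }
rewrite <- Rmult_assoc, <- norm_Cmod.
apply (norm_RInt_le (V := C_R_NormedModule)
  (fun r => Cmult (Cminus (dphi r) (Cmult (l r) (phi r)))
     (Cexp (Copp (CRInt l t0 r))))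
  (fun r => exp (- RInt (fun x => Re (l x)) t0 t) * eps
     * forward_integrand m t r) s s'); auto.
- intros r Hsr; specialize (Hr r Hsr); specialize (HJ r Hsr).
  rewrite norm_Cmod, Cmod_mult, Cmod_Cexp.
  change (Re (Copp (CRInt l t0 r))) with (- Re (CRInt l t0 r)).
  rewrite (Re_CRInt J), (RInt_Chasles_on J _ t0 t r) by assumption.
  rewrite Ropp_plus_distr, exp_plus.
  specialize (Heps r HJ); unfold forward_integrand.
  apply Rle_trans with (eps * (exp (- RInt (fun x => Re (l x)) t0 t) *
    exp (- RInt (fun x => Re (l x)) t r))).
  { apply Rmult_le_compat_r; [| exact Heps].
    left; apply Rmult_lt_0_compat; apply exp_pos. }
  rewrite (Rmult_comm _ eps), Rmult_assoc.
  apply Rmult_le_compat_l.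
  { apply Rle_trans with (2 := Heps); apply Cmod_ge_0. }
  apply Rmult_le_compat_l; [left; apply exp_pos |].
  destruct Hr as [Hr | Hr]; [left; apply exp_increasing; lra |].
  rewrite Hr; apply Rle_refl.
- apply (is_RInt_derive (V := C_R_CompleteNormedModule) (untwist l t0 phi)).
  + rewrite Rmin_left, Rmax_right by lra.
    intros r Hsr; apply is_derive_untwist with J; auto.
  + rewrite Rmin_left, Rmax_right by lra.
    intros r Hsr; specialize (HJ r Hsr).
    assert (cl := continuous_of_continuous_on J _ r (ho r HJ) hl).
    apply continuous_Cmult.
    * apply (continuous_minus (V := C_R_NormedModule) dphi).
      { apply (continuous_of_continuous_on J); auto. }
      apply (continuous_Cmult l phi); auto.
      apply (ex_derive_continuous (V := C_R_NormedModule)).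
      now exists (dphi r); apply Hphi.
    * apply (ex_derive_continuous (V := C_R_NormedModule)); eexists.
      apply is_derive_Cexp.
      apply (is_derive_opp (V := C_R_NormedModule) (CRInt l t0)).
      now apply (is_derive_RInt_open (V := C_R_CompleteNormedModule) J).
- apply (is_RInt_scal (V := R_NormedModule)); exact Hw.
Qed.

Lemma filterlim_Cmod_minus {T : Type} {F : (T -> Prop) -> Prop} {FF : Filter F}
    (f g : T -> C) (x y : C) :
  filterlim f F (locally (T := C_UniformSpace) x) ->
  filterlim g F (locally (T := C_UniformSpace) y) ->
  filterlim (fun s => Cmod (Cminus (f s) (g s))) F
    (locally (Cmod (Cminus x y))).
Proof.
intros Hf Hg; rewrite <- norm_Cmod.
apply filterlim_ext with
  (fun s => norm (V := C_R_NormedModule) (Cminus (f s) (g s))).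
{ intros s; apply norm_Cmod. }
apply filterlim_comp with
  (2 := filterlim_norm (V := C_R_NormedModule) (Cminus x y)).
apply (filterlim_comp_2 (G := locally (T := C_R_NormedModule) x)
  (H := locally (T := C_R_NormedModule) (Copp y)) f (fun s => Copp (g s)) Cplus Hf).
2: apply (filterlim_plus (V := C_R_NormedModule) x (Copp y)).
apply filterlim_comp with (1 := Hg).
apply (filterlim_opp (V := C_R_NormedModule) y).
Qed.

(* [F] is the filter of one end of [J], and [S t s] says that [s] lies
   between [t] and that end. *)
Record is_end (J : R -> Prop) (F : (R -> Prop) -> Prop)
    (S : R -> R -> Prop) : Prop := {
  end_proper : ProperFilter F;
  end_eventually : forall t, J t -> F (fun s => J s /\ S t s);
  end_refl : forall t, S t t;
  end_between : forall t s s' r, S t s -> S t s' ->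
    Rmin s s' <= r <= Rmax s s' -> S t r
}.

Lemma Cexp_untwist (l phi : R -> C) (t0 t : R) :
  Cmult (Cexp (CRInt l t0 t)) (untwist l t0 phi t) = phi t.
Proof.
unfold untwist.
rewrite (Cmult_comm (phi t)), Cmult_assoc, (Cmult_comm (Cexp _)), Cexp_opp_l.
apply Cmult_1_l.
Qed.

(** [v t] is an oriented limit: kappa(t) at the right end, minus kappa(t) at the left end, whence
    [Rabs (v t)] in the conclusion. *)
Lemma untwist_limit (J : R -> Prop) (F : (R -> Prop) -> Prop)
    (S : R -> R -> Prop) (l phi dphi : R -> C) (m v : R -> R) (eps t0 : R) :
  is_convex J -> (forall s, J s -> locally s J) ->
  continuous_on (U := C_UniformSpace) J l ->
  continuous_on (U := C_UniformSpace) J dphi -> continuous_on J m ->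
  (forall r, J r -> is_derive (V := C_R_NormedModule) phi r (dphi r)) ->
  (forall r, J r -> Cmod (Cminus (dphi r) (Cmult (l r) (phi r))) <= eps) ->
  J t0 -> is_end J F S ->
  (forall t s, J t -> J s -> S t s ->
     RInt m t s <= RInt (fun x => Re (l x)) t s) ->
  (forall t, J t ->
     filterlim (RInt (forward_integrand m t) t) F (locally (v t))) ->
  exists c : C,
    filterlim (untwist l t0 phi) F (locally (T := C_UniformSpace) c) /\
    forall t, J t ->
      Cmod (Cminus (phi t) (Cmult (Cexp (CRInt l t0 t)) c)) <= eps * Rabs (v t).
Proof.
intros hc ho hl hd hm Hphi Heps H0 [HF HE Hrefl Hbtw] Hm Hv.
assert (Heps0 : 0 <= eps).
{ apply Rle_trans with (2 := Heps t0 H0); apply Cmod_ge_0. }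
assert (Hinc : forall t s s', J t -> J s -> J s' -> S t s -> S t s' ->
  Cmod (Cminus (untwist l t0 phi s') (untwist l t0 phi s)) <=
  exp (- RInt (fun x => Re (l x)) t0 t) *
    (eps * Rabs (RInt (forward_integrand m t) s s'))).
{ intros t s s' Ht Hs Hs' Hts Hts'.
  apply untwist_increment with J dphi; auto.
  intros r Hr; apply Hm; auto.
  - now apply (is_convex_minmax J s s').
  - now apply (Hbtw t s s'). }
assert (Hc : exists c, filterlim (untwist l t0 phi) F
  (locally (T := C_R_CompleteNormedModule) c)).
{ apply (filterlim_locally_cauchy (U := C_R_CompleteNormedModule)).
  intros d.
  (* Only 0 <= eps is known, so the tolerance is divided by eps + 1; the product of eps with it is
     still below d. *)
  assert (Hd : 0 < d / (eps + 1)).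
  { apply Rdiv_lt_0_compat; [apply cond_pos | lra]. }
  destruct (proj2 (filterlim_locally_cauchy (U := R_CompleteSpace) (F := F)
    (RInt (forward_integrand m t0) t0))
    (ex_intro (fun y : R => filterlim _ F (locally y)) _ (Hv t0 H0)) (mkposreal _ Hd)) as [P [HP HPb]].
  exists (fun s => P s /\ J s /\ S t0 s); split.
  { apply filter_and; [exact HP | now apply HE]. }
  intros s s' (Ps & Js & Ss) (Ps' & Js' & Ss').
  apply (norm_compat1 (V := C_R_NormedModule)).
  rewrite norm_Cmod.
  apply Rle_lt_trans with (1 := Hinc t0 s s' H0 Js Js' Ss Ss').
  (* For the Cauchy property the estimate is anchored at t0, where the exponential prefactor is
     1. *)
  rewrite (RInt_point t0); change (zero : R) with 0; rewrite Ropp_0, exp_0, Rmult_1_l.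
  specialize (HPb s s' Ps Ps').
  change (Rabs (RInt (forward_integrand m t0) t0 s' -
    RInt (forward_integrand m t0) t0 s) < d / (eps + 1)) in HPb.
  replace (RInt (forward_integrand m t0) s s') with
    (RInt (forward_integrand m t0) t0 s' - RInt (forward_integrand m t0) t0 s).
  2: { rewrite <- (RInt_Chasles (forward_integrand m t0) t0 s s').
       - unfold plus; simpl; ring.
       - now apply ex_RInt_weight with J.
       - now apply ex_RInt_weight with J. }
  apply Rle_lt_trans with (eps * (d / (eps + 1))).
  { apply Rmult_le_compat_l; lra. }
  apply Rlt_le_trans with ((eps + 1) * (d / (eps + 1))).
  { apply Rmult_lt_compat_r; lra. }
  right; field; lra. }
destruct Hc as [c Hc]; exists c; split; [exact Hc |].
intros t Ht.
(* Now the anchor is t itself: the increment from t to s is bounded, and s tends to the end. *)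
assert (Hle : Cmod (Cminus c (untwist l t0 phi t)) <=
  exp (- RInt (fun x => Re (l x)) t0 t) * (eps * Rabs (v t))).
{ apply (filterlim_le (F := F)
    (fun s => Cmod (Cminus (untwist l t0 phi s) (untwist l t0 phi t)))
    (fun s => exp (- RInt (fun x => Re (l x)) t0 t) *
      (eps * Rabs (RInt (forward_integrand m t) t s)))
    (Finite _) (Finite _)).
  - generalize (HE t Ht); apply filter_imp; intros s [Js Sts].
    now apply Hinc.
  - apply filterlim_Cmod_minus; [exact Hc | apply filterlim_const].
  - apply (filterlim_comp _ _ _ (RInt (forward_integrand m t) t)
      (fun x => exp (- RInt (fun x => Re (l x)) t0 t) * (eps * Rabs x))
      _ _ _ (Hv t Ht)).
    apply (continuous_scal_r (V := R_NormedModule) _ (fun x => eps * Rabs x)).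
    apply (continuous_scal_r (V := R_NormedModule) eps Rabs).
    apply continuous_Rabs. }
(* With phi(t) written as the exponential times [untwist], the exponential factors out of the
   difference; its modulus cancels the prefactor of [Hle]. *)
rewrite <- (Cexp_untwist l phi t0 t) at 1.
replace (Cminus _ _) with
  (Cmult (Cexp (CRInt l t0 t)) (Copp (Cminus c (untwist l t0 phi t)))) by ring.
rewrite Cmod_mult, Cmod_opp, Cmod_Cexp, (Re_CRInt J) by assumption.
apply Rle_trans with (exp (RInt (fun r => Re (l r)) t0 t) *
  (exp (- RInt (fun x => Re (l x)) t0 t) * (eps * Rabs (v t)))).
{ apply Rmult_le_compat_l; [left; apply exp_pos | exact Hle]. }
rewrite <- Rmult_assoc, <- exp_plus, Rplus_opp_r, exp_0; lra.
Qed.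

(** The bounds r and r' are arbitrary: the growth of the exponential excludes a second solution at
    any finite distance from phi. *)
Lemma homogeneous_solution_unique (J : R -> Prop) (F : (R -> Prop) -> Prop)
    {HF : ProperFilter F} (l phi y : R -> C) (c : C) (r r' t0 : R) :
  is_convex J -> (forall s, J s -> locally s J) ->
  continuous_on (U := C_UniformSpace) J l -> J t0 -> F J ->
  filterlim (RInt (fun x => Re (l x)) t0) F (Rbar_locally p_infty) ->
  (forall s, J s -> is_derive (V := C_R_NormedModule) y s (Cmult (l s) (y s))) ->
  (forall s, J s -> Cmod (Cminus (phi s) (y s)) <= r) ->
  (forall s, J s ->
     Cmod (Cminus (phi s) (Cmult (Cexp (CRInt l t0 s)) c)) <= r') ->
  forall t, J t -> y t = Cmult (Cexp (CRInt l t0 t)) c.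
Proof.
intros hc ho hl H0 HFJ Hinf Hy Hr Hr'.
set (d := untwist l t0 y t0).
assert (Hcst : forall s, J s -> y s = Cmult (Cexp (CRInt l t0 s)) d).
{ intros s Hs; rewrite <- (Cexp_untwist l y t0 s) at 1; apply f_equal.
  (* An exact solution has defect 0, so the increment estimate with eps = 0 makes its [untwist]
     constant. *)
  assert (H : Cmod (Cminus (untwist l t0 y s) d) <= 0).
  { eapply Rle_trans.
    - apply (untwist_increment J l y (fun s => Cmult (l s) (y s))
        (fun x => Re (l x)) 0 t0 t0 t0 s); auto.
      + intros u Hu.
        eapply filterlim_filter_le_1; [apply filter_le_within |].
        apply continuous_Cmult.
        * now apply continuous_of_continuous_on with J; auto.
        * apply (ex_derive_continuous (V := C_R_NormedModule)).
          eexists; now apply Hy.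
      + now apply continuous_on_Re.
      + intros u Hu; replace (Cminus _ _) with (RtoC 0) by ring.
        rewrite Cmod_0; apply Rle_refl.
      + intros u _; apply Rle_refl.
    - right; ring. }
  apply Ceq_minus.
  apply Cmod_eq_0, Rle_antisym; [exact H | apply Cmod_ge_0]. }
assert (Hdc : forall s, J s ->
  exp (RInt (fun x => Re (l x)) t0 s) * Cmod (Cminus d c) <= r + r').
{ intros s Hs; rewrite <- (Re_CRInt J), <- Cmod_Cexp, <- Cmod_mult by assumption.
  replace (Cmult _ _) with (Cplus (Copp (Cminus (phi s) (y s)))
    (Cminus (phi s) (Cmult (Cexp (CRInt l t0 s)) c))).
  2: { rewrite (Hcst s Hs); ring. }
  apply Rle_trans with (1 := Cmod_triangle _ _).
  rewrite Cmod_opp; apply Rplus_le_compat; auto. }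
assert (Hd : d = c).
{ apply Ceq_minus, Cmod_eq_0.
  destruct (Cmod_ge_0 (Cminus d c)) as [Hpos | Heq]; [| now symmetry].
  exfalso.
  (* Chosen so that q |d - c| = r + r'. Where the integral x exceeds q, exp x >= 1 + x > q
     contradicts [Hdc]. *)
  set (q := (r + r') / Cmod (Cminus d c)).
  assert (Hlim : F (fun s => q < RInt (fun x => Re (l x)) t0 s)).
  { apply Hinf; now exists q. }
  destruct (filter_ex _ (filter_and _ _ HFJ Hlim)) as [s [Hs Hq]].
  specialize (Hdc s Hs).
  assert (H1 := exp_ineq1_le (RInt (fun x => Re (l x)) t0 s)).
  assert (q * Cmod (Cminus d c) = r + r') by (unfold q; field; lra).
  nra. }
now rewrite <- Hd.
Qed.

(** * The interval and its ends *)

Definition interior_of (a b : Rbar) (t : R) : Prop := Rbar_lt a t /\ Rbar_lt t b.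

Lemma is_convex_interior (a b : Rbar) : is_convex (interior_of a b).
Proof.
intros u v w [Hu _] [_ Hv] [H1 H2]; split.
- now apply Rbar_lt_le_trans with u.
- now apply Rbar_le_lt_trans with v.
Qed.

Lemma is_convex_interval (a b : Rbar) (I : R -> Prop) :
  interval_with_ends a b I -> is_convex I.
Proof.
intros [H | [H | [H | H]]] u v w Hu Hv [H1 H2];
  apply H in Hu; apply H in Hv; apply H;
  destruct Hu as [Hu _]; destruct Hv as [_ Hv];
  destruct a as [a | |]; destruct b as [b | |]; simpl in *; lra.
Qed.

Lemma interior_open (a b : Rbar) (t : R) :
  interior_of a b t -> locally t (interior_of a b).
Proof.
intros [H1 H2]; apply filter_and.
- now apply (open_Rbar_gt' t a).
- now apply (open_Rbar_lt' t b).
Qed.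

Lemma interior_subset (a b : Rbar) (I : R -> Prop) (t : R) :
  interval_with_ends a b I -> interior_of a b t -> I t.
Proof.
intros [H | [H | [H | H]]] [H1 H2]; apply H; split; auto;
  now apply Rbar_lt_le.
Qed.

(** The points t + k (t0 - t) with 0 < k <= 1 are interior and tend to t as k tends to 0, so even an
    end belonging to [I] is approached from the interior. *)
Lemma within_interior_proper (a b : Rbar) (I : R -> Prop) (t0 t : R) :
  interval_with_ends a b I -> interior_of a b t0 -> I t ->
  ProperFilter (within (interior_of a b) (locally t)).
Proof.
intros hI H0 Ht; split; [| apply within_filter, locally_filter].
intros P [d Hd].
assert (Hseg : forall k, 0 < k <= 1 -> interior_of a b (t + k * (t0 - t))).
{ intros k Hk.
  assert (Hab : Rbar_le a t /\ Rbar_le t b).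
  { destruct hI as [H | [H | [H | H]]]; apply H in Ht; destruct Ht; split; auto;
      now apply Rbar_lt_le. }
  destruct H0 as [H1 H2]; destruct Hab as [H3 H4]; split;
  [clear H2 H4; destruct a as [a | |] | clear H1 H3; destruct b as [b | |]];
  simpl in *; try easy; nra. }
(* Adding 1 covers the case t = t0; the factor 2 yields a strict inequality. *)
set (k := Rmin 1 (d / (2 * (Rabs (t0 - t) + 1)))).
assert (Hpos := Rabs_pos (t0 - t)).
assert (Hd' : 0 < d / (2 * (Rabs (t0 - t) + 1))).
{ apply Rdiv_lt_0_compat; [apply cond_pos | lra]. }
assert (Hk : 0 < k <= 1).
{ split; [apply Rmin_pos; lra | apply Rmin_l]. }
exists (t + k * (t0 - t)); apply Hd; [| now apply Hseg].
change (Rabs (t + k * (t0 - t) - t) < d).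
replace (t + k * (t0 - t) - t) with (k * (t0 - t)) by ring.
rewrite Rabs_mult, (Rabs_pos_eq k) by lra.
assert (Hk2 : k <= d / (2 * (Rabs (t0 - t) + 1))) by apply Rmin_r.
apply Rle_lt_trans with (d / (2 * (Rabs (t0 - t) + 1)) * (Rabs (t0 - t) + 1)).
{ apply Rmult_le_compat; lra. }
replace (d / _ * _) with (d / 2) by (field; lra).
generalize (cond_pos d); lra.
Qed.

(** Carries to the ends of [I] both the Ulam estimate and, with r = 0, the coincidence of two
    solutions. *)
Lemma le_on_interval_of_interior (a b : Rbar) (I : R -> Prop) (t0 t : R)
    (h : R -> R) (r : R) :
  interval_with_ends a b I -> interior_of a b t0 -> I t ->
  filterlim h (within I (locally t)) (locally (h t)) ->
  (forall s, interior_of a b s -> h s <= r) -> h t <= r.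
Proof.
intros hI H0 Ht Hh Hr.
assert (HP := within_interior_proper a b I t0 t hI H0 Ht).
apply (filterlim_le (F := within (interior_of a b) (locally t))
  h (fun _ => r) (Finite (h t)) (Finite r)).
- exists (mkposreal 1 Rlt_0_1); intros s _; apply Hr.
- intros P HQ; generalize (Hh P HQ); unfold filtermap, within; apply filter_imp.
  intros s Hs HJ; apply Hs; now apply (interior_subset a b).
- apply filterlim_const.
Qed.

Lemma is_end_left (a b : Rbar) (t0 : R) : interior_of a b t0 ->
  is_end (interior_of a b) (Rbar_at_left b) Rle.
Proof.
intros H0; split.
- split.
  2: exact (@within_filter R (fun t : R => Rbar_lt t b) _
       (@filter_filter _ _ (Rbar_locally_filter b))).
  (* For finite b the filter is [at_left b] by conversion; b = -infinity contradicts t0 < b. *)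
  destruct b as [b | |].
  + intros P HP.
    exact (filter_ex (F := at_left b) P HP).
  + intros P [M HM]; exists (M + 1); apply HM; simpl; auto; lra.
  + now destruct H0.
- intros t [Ht1 Ht2]; unfold Rbar_at_left, within.
  assert (Hl : Rbar_locally b (fun s => t < s)).
  { destruct b as [b | |]; simpl in *.
    - now apply open_gt.
    - now exists t.
    - easy. }
  revert Hl; apply filter_imp; intros s Hs Hsb; split.
  + split; auto; apply Rbar_lt_trans with t; auto.
  + now left.
- intros t; apply Rle_refl.
- intros t s s' r H1 H2 [H3 _]; apply Rle_trans with (2 := H3).
  now apply Rmin_glb.
Qed.

Lemma is_end_right (a b : Rbar) (t0 : R) : interior_of a b t0 ->
  is_end (interior_of a b) (Rbar_at_right a) Rge.
Proof.
intros H0; split.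
- split.
  2: exact (@within_filter R (fun t : R => Rbar_lt a t) _
       (@filter_filter _ _ (Rbar_locally_filter a))).
  destruct a as [a | |].
  + intros P HP.
    exact (filter_ex (F := at_right a) P HP).
  + now destruct H0.
  + intros P [M HM]; exists (M - 1); apply HM; simpl; auto; lra.
- intros t [Ht1 Ht2]; unfold Rbar_at_right, within.
  assert (Hl : Rbar_locally a (fun s => s < t)).
  { destruct a as [a | |]; simpl in *.
    - now apply open_lt.
    - easy.
    - now exists t. }
  revert Hl; apply filter_imp; intros s Hs Hsb; split.
  + split; auto; apply Rbar_lt_trans with t; auto.
  + now apply Rgt_ge.
- intros t; apply Rle_refl.
- intros t s s' r H1 H2 [_ H3]; apply Rle_ge, Rle_trans with (1 := H3).
  apply Rmax_lub; now apply Rge_le.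
Qed.

(** * Suprema on the interval, and the improper integrals as oriented limits *)

Lemma sup_on_le (I : R -> Prop) (f : R -> R) (r : R) :
  Rbar_le (sup_on I f) r <-> forall t, I t -> f t <= r.
Proof.
destruct (Lub_Rbar_correct (fun y => exists t, I t /\ y = f t)) as [H1 H2].
split.
- intros H t Ht.
  apply (Rbar_le_trans (f t) (sup_on I f) r); auto.
  apply H1; now exists t.
- intros H; apply H2; intros y [t [Ht ->]]; now apply H.
Qed.

(** [real] sends both infinities to 0: +infinity is excluded by hypothesis, -infinity by the value
    [f t]. *)
Lemma le_real_sup_on (I : R -> Prop) (f : R -> R) (t : R) :
  Rbar_lt (sup_on I f) p_infty -> I t -> f t <= real (sup_on I f).
Proof.
intros H Ht.
destruct (Lub_Rbar_correct (fun y => exists t, I t /\ y = f t)) as [H1 _].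
assert (H2 : Rbar_le (f t) (sup_on I f)) by (apply H1; now exists t).
destruct (sup_on I f); simpl in *; easy.
Qed.

(** [RInt_gen] is a limit along the product of [at_point t] and the end filter; evaluating the first
    factor at t leaves an ordinary limit. *)
Lemma filterlim_forward (b : Rbar) (m : R -> R) (t : R) :
  ProperFilter (Rbar_at_left b) -> ex_forward b m t ->
  filterlim (RInt (forward_integrand m t) t) (Rbar_at_left b)
    (locally (forward b m t)).
Proof.
intros HF H.
apply (RInt_gen_correct (V := R_CompleteNormedModule) (Fa := at_point t)
  (Fb := Rbar_at_left b) (forward_integrand m t)) in H.
intros P HP; destruct (H P HP) as [Q Q' HQ HQ' HI].
revert HQ'; unfold filtermap; apply filter_imp; intros s Hs.
destruct (HI t s HQ Hs) as [y [Hy HPy]].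
now rewrite (is_RInt_unique (forward_integrand m t) t s y Hy).
Qed.

(** Since exp(int_r^t m) = exp(- int_t^r m), the two integrands agree on the interior. Only the
    outer integral changes orientation, hence the minus sign. *)
Lemma filterlim_backward (a b : Rbar) (m : R -> R) (t : R) :
  continuous_on (interior_of a b) m -> interior_of a b t ->
  ex_backward a m t ->
  filterlim (RInt (forward_integrand m t) t) (Rbar_at_right a)
    (locally (- backward a m t)).
Proof.
intros hm Ht H.
destruct (is_end_right a b t Ht) as [HF HE _ _].
assert (hc := is_convex_interior a b).
apply (RInt_gen_correct (V := R_CompleteNormedModule) (Fa := Rbar_at_right a)
  (Fb := at_point t) (backward_integrand m t)) in H.
assert (Hl : filterlim (fun s => RInt (backward_integrand m t) s t)
  (Rbar_at_right a) (locally (backward a m t))).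
{ intros P HP; destruct (H P HP) as [Q Q' HQ HQ' HI].
  revert HQ; unfold filtermap; apply filter_imp; intros s Hs.
  destruct (HI s t Hs HQ') as [y [Hy HPy]].
  now rewrite (is_RInt_unique (backward_integrand m t) s t y Hy). }
apply filterlim_ext_loc with (fun s => - RInt (backward_integrand m t) s t).
- generalize (HE t Ht); apply filter_imp; intros s [Hs _].
  rewrite <- (opp_RInt_swap (forward_integrand m t) s t).
  2: { apply ex_RInt_weight with (interior_of a b); auto.
       apply interior_open. }
  change opp with Ropp; apply f_equal, RInt_ext; intros r Hr.
  assert (Hr' : interior_of a b r).
  { apply (is_convex_minmax _ s t r hc Hs Ht); lra. }
  unfold backward_integrand, forward_integrand; apply f_equal.
  symmetry; apply (opp_RInt_swap m t r).
  now apply (ex_RInt_continuous_on (V := R_CompleteNormedModule) (interior_of a b)).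
- apply filterlim_comp with (1 := Hl).
  apply (filterlim_opp (V := R_NormedModule)).
Qed.

(** The integrand is positive, so the improper integral is at least the positive integral over a
    short segment [t, t1]. *)
Lemma forward_pos (a b : Rbar) (m : R -> R) (t : R) :
  continuous_on (interior_of a b) m -> interior_of a b t ->
  ex_forward b m t -> 0 < forward b m t.
Proof.
intros hm Ht H.
destruct (is_end_left a b t Ht) as [HF HE _ _].
assert (hc := is_convex_interior a b).
assert (ho := interior_open a b).
assert (Hlim := filterlim_forward b m t HF H).
assert (Ht1 : exists t1, interior_of a b t1 /\ t < t1).
{ destruct (ho t Ht) as [d Hd]; exists (t + d / 2).
  assert (Hp := cond_pos d); split; [| lra].
  apply Hd; change (Rabs (t + d / 2 - t) < d).
  rewrite Rabs_pos_eq; lra. }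
destruct Ht1 as [t1 [Ht1 Htt1]].
apply Rlt_le_trans with (RInt (forward_integrand m t) t t1).
{ apply RInt_gt_0; auto.
  - intros x _; apply exp_pos.
  - intros x Hx; apply continuous_weight with (interior_of a b); auto.
    now apply (hc t t1). }
apply (filterlim_le (F := Rbar_at_left b)
  (fun _ => RInt (forward_integrand m t) t t1) (RInt (forward_integrand m t) t)
  (Finite _) (Finite _)).
- generalize (HE t1 Ht1); apply filter_imp; intros s [Hs Hle].
  rewrite <- (RInt_Chasles (forward_integrand m t) t t1 s)
    by now apply ex_RInt_weight with (interior_of a b).
  change plus with Rplus.
  assert (0 <= RInt (forward_integrand m t) t1 s).
  { apply RInt_ge_0; auto.
    - now apply ex_RInt_weight with (interior_of a b).
    - intros x _; left; apply exp_pos. }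
  lra.
- apply filterlim_const.
- exact Hlim.
Qed.

Lemma backward_pos (a b : Rbar) (m : R -> R) (t : R) :
  continuous_on (interior_of a b) m -> interior_of a b t ->
  ex_backward a m t -> 0 < backward a m t.
Proof.
intros hm Ht H.
destruct (is_end_right a b t Ht) as [HF HE _ _].
assert (hc := is_convex_interior a b).
assert (ho := interior_open a b).
assert (Hlim := filterlim_backward a b m t hm Ht H).
assert (Ht1 : exists t1, interior_of a b t1 /\ t1 < t).
{ destruct (ho t Ht) as [d Hd]; exists (t - d / 2).
  assert (Hp := cond_pos d); split; [| lra].
  apply Hd; change (Rabs (t - d / 2 - t) < d).
  rewrite Rabs_left; lra. }
destruct Ht1 as [t1 [Ht1 Htt1]].
assert (Hpos : 0 < RInt (forward_integrand m t) t1 t).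
{ apply RInt_gt_0; auto.
  - intros x _; apply exp_pos.
  - intros x Hx; apply continuous_weight with (interior_of a b); auto.
    now apply (hc t1 t). }
enough (- backward a m t <= - RInt (forward_integrand m t) t1 t) by lra.
apply (filterlim_le (F := Rbar_at_right a)
  (RInt (forward_integrand m t) t) (fun _ => - RInt (forward_integrand m t) t1 t)
  (Finite _) (Finite _)).
- generalize (HE t1 Ht1); apply filter_imp; intros s [Hs Hle].
  rewrite <- (opp_RInt_swap (forward_integrand m t) s t)
    by now apply ex_RInt_weight with (interior_of a b).
  rewrite <- (RInt_Chasles (forward_integrand m t) s t1 t)
    by now apply ex_RInt_weight with (interior_of a b).
  change plus with Rplus; change opp with Ropp.
  assert (0 <= RInt (forward_integrand m t) s t1).
  { apply RInt_ge_0.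
    - now apply Rge_le.
    - now apply ex_RInt_weight with (interior_of a b).
    - intros x _; left; apply exp_pos. }
  lra.
- exact Hlim.
- apply filterlim_const.
Qed.

Lemma filterlim_Rmin {T : Type} {F : (T -> Prop) -> Prop} {FF : Filter F}
    (f g : T -> R) (x y : R) :
  filterlim f F (locally x) -> filterlim g F (locally y) ->
  filterlim (fun s => Rmin (f s) (g s)) F (locally (Rmin x y)).
Proof.
rewrite !filterlim_locally; intros Hf Hg e.
generalize (filter_and _ _ (Hf e) (Hg e)); apply filter_imp; intros s.
change (Rabs (f s - x) < e /\ Rabs (g s - y) < e ->
  Rabs (Rmin (f s) (g s) - Rmin x y) < e).
intros [H1 H2]; apply Rabs_def2 in H1; apply Rabs_def2 in H2.
apply Rabs_def1; unfold Rmin; destruct (Rle_dec _ _); destruct (Rle_dec _ _); lra.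
Qed.

Lemma continuous_on_min_Re (J : R -> Prop) (l1 l2 : R -> C) :
  continuous_on (U := C_UniformSpace) J l1 ->
  continuous_on (U := C_UniformSpace) J l2 -> continuous_on J (min_Re l1 l2).
Proof.
intros h1 h2 t Ht; apply filterlim_Rmin; now apply continuous_on_Re.
Qed.

Lemma continuous_on_max_Re (J : R -> Prop) (l1 l2 : R -> C) :
  continuous_on (U := C_UniformSpace) J l1 ->
  continuous_on (U := C_UniformSpace) J l2 -> continuous_on J (max_Re l1 l2).
Proof.
intros h1 h2 t Ht; unfold max_Re.
rewrite <- (Ropp_involutive (Rmax _ _)), <- Rmin_opp_Rmax.
apply filterlim_ext with (fun s => - Rmin (- Re (l1 s)) (- Re (l2 s))).
{ intros s; now rewrite Rmin_opp_Rmax, Ropp_involutive. }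
eapply filterlim_comp; [| apply (filterlim_opp (V := R_NormedModule))].
apply filterlim_Rmin;
  (eapply filterlim_comp; [| apply (filterlim_opp (V := R_NormedModule))]);
  now apply continuous_on_Re.
Qed.

(** * Relative derivatives and the diagonal system *)

Lemma is_filter_lim_within (I : R -> Prop) (t : R) :
  is_filter_lim (T := R_NormedModule) (within I (locally t)) t.
Proof. intros P HP; unfold within; revert HP; apply filter_imp; auto. Qed.

Lemma is_derive_in_continuous (I : R -> Prop) (f : R -> C2) (t : R) (l : C2) :
  is_derive_in I f t l ->
  filterlim (fun s => fst (f s)) (within I (locally t))
    (locally (T := C_UniformSpace) (fst (f t))) /\
  filterlim (fun s => snd (f s)) (within I (locally t))
    (locally (T := C_UniformSpace) (snd (f t))).
Proof.
intros H.
assert (Hc : filterlim f (within I (locally t)) (locally (f t))).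
{ apply (filterdiff_continuous_aux (F := within I (locally t)) f 
    (ex_intro (filterdiff f (within I (locally t))) _ H)).
  apply is_filter_lim_within. }
destruct (f t) as [x y]; split.
- exact (filterlim_comp _ _ _ f fst _ _ _ Hc
    (continuous_fst (U := C_UniformSpace) (V := C_UniformSpace) x y)).
- exact (filterlim_comp _ _ _ f snd _ _ _ Hc
    (continuous_snd (U := C_UniformSpace) (V := C_UniformSpace) x y)).
Qed.

Lemma is_derive_in_interior (I : R -> Prop) (f : R -> C2) (t : R) (l : C2) :
  locally t I -> is_derive_in I f t l ->
  is_derive (V := C_R_NormedModule) (fun s => fst (f s)) t (fst l) /\
  is_derive (V := C_R_NormedModule) (fun s => snd (f s)) t (snd l).
Proof.
intros HI [Hlin Hdom].
assert (H : filterdiff f (locally t) (fun h : R => scal h l)).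
{ split; [exact Hlin |]; intros x Hx eps.
  (* [filterdiff] quantifies over limit points of its filter, so a limit point of [locally t] must
     be recognised as one of the restricted filter. *)
  assert (Hx' : is_filter_lim (T := R_NormedModule) (within I (locally t)) x).
  { intros P HP; unfold within; generalize (Hx P HP); apply filter_imp; auto. }
  generalize (filter_and _ _ HI (Hdom x Hx' eps)); apply filter_imp.
  now intros y [H1 H2]; apply H2. }
exact (filterdiff_fst_snd (F := locally t) (V := C_R_NormedModule)
  (W := C_R_NormedModule) f _ H).
Qed.

(** A relative derivative sees f only on [I] near t, so it can be computed from functions
    differentiable on both sides, such as those built from [local_primitive]. *)
Lemma is_derive_in_of_extension (I : R -> Prop) (f : R -> C2) (g1 g2 : R -> C)
    (t : R) (l1 l2 : C) :
  I t ->
  is_derive (V := C_R_NormedModule) g1 t l1 ->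
  is_derive (V := C_R_NormedModule) g2 t l2 ->
  locally t (fun s => I s -> (g1 s, g2 s) = f s) ->
  is_derive_in I f t (l1, l2).
Proof.
intros Ht H1 H2 Heq.
(* Properness, due to t lying in [I], makes t the unique limit point of the restricted filter. *)
assert (HP : ProperFilter (within I (locally t))).
{ split; [| apply within_filter, locally_filter].
  intros P HP; exists t; exact (locally_singleton _ _ HP Ht). }
apply (filterdiff_ext_loc (F := within I (locally t))
  (fun s => (g1 s, g2 s) : C2)).
- exact Heq.
- intros x Hx.
  rewrite (is_filter_lim_unique (V := R_NormedModule) x t Hx
    (is_filter_lim_within I t)).
  exact (locally_singleton _ _ Heq Ht).
- apply (filterdiff_locally (F := within I (locally t)) _ t).
  { apply is_filter_lim_within. }
  exact (filterdiff_pair (F := locally t) (V := C_R_NormedModule)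
    (W := C_R_NormedModule) g1 g2 _ _ H1 H2).
Qed.

Lemma mulv_diag2 (x y : C) (v : C2) :
  mulv (diag2 x y) v = (Cmult x (fst v), Cmult y (snd v)).
Proof.
unfold mulv, diag2, entry, mat2; rewrite !coeff_mat_bij by auto with arith.
apply f_equal2; ring.
Qed.

Lemma inv2_diag2 (x y : C) : x <> RtoC 0 -> y <> RtoC 0 ->
  inv2 (diag2 x y) = diag2 (Cinv x) (Cinv y).
Proof.
intros Hx Hy; unfold inv2, det2, diag2, entry.
unfold mat2 at 1; apply mk_matrix_ext; intros i j Hi Hj.
unfold mat2; rewrite !coeff_mat_bij by auto with arith.
destruct i as [| i]; destruct j as [| j]; field; auto.
Qed.

Lemma Cinv_Cexp (z : C) : Cinv (Cexp z) = Cexp (Copp z).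
Proof.
assert (H := Cexp_opp_l z).
rewrite <- (Cmult_1_l (Cinv (Cexp z))), <- H, <- Cmult_assoc, Cinv_r.
- apply Cmult_1_r.
- apply Cexp_neq_0.
Qed.

Lemma mulv_inv2_Xdiag (l1 l2 : R -> C) (t0 t : R) (phi : R -> C2) :
  mulv (inv2 (Xdiag l1 l2 t0 t)) (phi t) =
  (untwist l1 t0 (fun s => fst (phi s)) t, untwist l2 t0 (fun s => snd (phi s)) t).
Proof.
unfold Xdiag; rewrite inv2_diag2 by apply Cexp_neq_0.
rewrite mulv_diag2, !Cinv_Cexp; unfold untwist.
apply f_equal2; apply Cmult_comm.
Qed.

Lemma filterlim_C2 {T : Type} {F : (T -> Prop) -> Prop} {FF : Filter F}
    (f g : T -> C) (x y : C) :
  filterlim f F (locally (T := C_UniformSpace) x) ->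
  filterlim g F (locally (T := C_UniformSpace) y) ->
  filterlim (fun s => (f s, g s)) F (locally (T := C2) (x, y)).
Proof.
rewrite !(filterlim_locally (U := C_UniformSpace)); intros Hf Hg.
apply (filterlim_locally (U := C2)); intros e.
generalize (filter_and _ _ (Hf e) (Hg e)); apply filter_imp.
intros s [H1 H2]; now split.
Qed.

Lemma is_solution_Xdiag (I : R -> Prop) (l1 l2 : R -> C) (t0 : R) (c : C2) :
  is_convex I ->
  continuous_on (U := C_UniformSpace) I l1 ->
  continuous_on (U := C_UniformSpace) I l2 -> I t0 ->
  is_solution (Adiag l1 l2) I (fun t => mulv (Xdiag l1 l2 t0 t) c).
Proof.
intros hc h1 h2 H0 t Ht.
(* At an end of [I] the integral of the total function may fail to be differentiable; the local
   primitives L1 and L2 replace it there. *)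
destruct (local_primitive (V := C_R_CompleteNormedModule) I l1 t0 t hc h1 H0 Ht)
  as (L1 & HL1 & E1).
destruct (local_primitive (V := C_R_CompleteNormedModule) I l2 t0 t hc h2 H0 Ht)
  as (L2 & HL2 & E2).
assert (H1 := locally_singleton _ _ E1 Ht); simpl in H1.
assert (H2 := locally_singleton _ _ E2 Ht); simpl in H2.
unfold Adiag, Xdiag; rewrite !mulv_diag2; simpl fst; simpl snd.
unfold CRInt; rewrite H1, H2.
apply is_derive_in_of_extension with
  (fun s => Cmult (Cexp (L1 s)) (fst c)) (fun s => Cmult (Cexp (L2 s)) (snd c)); auto.
- evar_last.
  { apply is_derive_Cmult; [apply is_derive_Cexp; exact HL1 |].
    apply (is_derive_const (V := C_R_NormedModule)). }
  change (zero : C) with (RtoC 0); simpl; ring.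
- evar_last.
  { apply is_derive_Cmult; [apply is_derive_Cexp; exact HL2 |].
    apply (is_derive_const (V := C_R_NormedModule)). }
  change (zero : C) with (RtoC 0); simpl; ring.
- generalize (filter_and _ _ E1 E2); apply filter_imp.
  intros s [E1s E2s] Hs; rewrite mulv_diag2, (E1s Hs), (E2s Hs); reflexivity.
Qed.

Lemma norm_inf_minus_diag (x y : C) (v w : C2) :
  norm_inf (minus v (mulv (diag2 x y) w)) =
  Rmax (Cmod (Cminus (fst v) (Cmult x (fst w))))
       (Cmod (Cminus (snd v) (Cmult y (snd w)))).
Proof. now rewrite mulv_diag2. Qed.

Lemma is_approx_solution_components (a b : Rbar) (I : R -> Prop)
    (l1 l2 : R -> C) (eps : R) (phi : R -> C2) :
  interval_with_ends a b I -> is_approx_solution (Adiag l1 l2) I eps phi ->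
  exists d1 d2 : R -> C,
    continuous_on (U := C_UniformSpace) (interior_of a b) d1 /\
    continuous_on (U := C_UniformSpace) (interior_of a b) d2 /\
    forall t, interior_of a b t ->
      (is_derive (V := C_R_NormedModule) (fun s => fst (phi s)) t (d1 t) /\
       Cmod (Cminus (d1 t) (Cmult (l1 t) (fst (phi t)))) <= eps) /\
      (is_derive (V := C_R_NormedModule) (fun s => snd (phi s)) t (d2 t) /\
       Cmod (Cminus (d2 t) (Cmult (l2 t) (snd (phi t)))) <= eps).
Proof.
intros hI (d & Hd & Hc & Hs).
assert (hJ : forall t, interior_of a b t -> I t).
{ intros t; now apply (interior_subset a b). }
assert (Hcc : forall t, I t ->
  filterlim (fun s => fst (d s)) (within I (locally t))
    (locally (T := C_UniformSpace) (fst (d t))) /\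
  filterlim (fun s => snd (d s)) (within I (locally t))
    (locally (T := C_UniformSpace) (snd (d t)))).
{ intros t Ht; specialize (Hc t Ht); destruct (d t) as [x y]; split.
  - exact (filterlim_comp _ _ _ d fst _ _ _ Hc
      (continuous_fst (U := C_UniformSpace) (V := C_UniformSpace) x y)).
  - exact (filterlim_comp _ _ _ d snd _ _ _ Hc
      (continuous_snd (U := C_UniformSpace) (V := C_UniformSpace) x y)). }
exists (fun t => fst (d t)), (fun t => snd (d t)); split; [| split].
- apply (continuous_on_subset I); auto; intros t Ht; now apply Hcc.
- apply (continuous_on_subset I); auto; intros t Ht; now apply Hcc.
- intros t Ht.
  assert (HtI : locally t I).
  { generalize (interior_open a b t Ht); apply filter_imp; auto. }
  destruct (is_derive_in_interior I phi t (d t) HtI (Hd t (hJ t Ht))) as [D1 D2].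
  assert (Hn := proj1 (sup_on_le _ _ _) Hs t (hJ t Ht)).
  simpl in Hn; unfold Adiag in Hn; rewrite norm_inf_minus_diag in Hn.
  split; split; auto; apply Rle_trans with (2 := Hn);
    [apply Rmax_l | apply Rmax_r].
Qed.

(** Each component has its own end, comparison function and oriented limit: (i) uses the right end
    twice, (ii) the left end twice, (iii) one of each. *)
Lemma diagonal_Ulam (a b : Rbar) (I : R -> Prop) (l1 l2 : R -> C) (t0 K : R)
    (F1 F2 : (R -> Prop) -> Prop) (S1 S2 : R -> R -> Prop)
    (m1 m2 v1 v2 : R -> R) (eps : R) (phi : R -> C2) :
  let J := interior_of a b in
  interval_with_ends a b I ->
  continuous_on (U := C_UniformSpace) I l1 ->
  continuous_on (U := C_UniformSpace) I l2 -> J t0 ->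
  is_end J F1 S1 -> is_end J F2 S2 ->
  continuous_on J m1 -> continuous_on J m2 ->
  (forall t s, J t -> J s -> S1 t s ->
     RInt m1 t s <= RInt (fun x => Re (l1 x)) t s) ->
  (forall t s, J t -> J s -> S2 t s ->
     RInt m2 t s <= RInt (fun x => Re (l2 x)) t s) ->
  (forall t, J t ->
     filterlim (RInt (forward_integrand m1 t) t) F1 (locally (v1 t))) ->
  (forall t, J t ->
     filterlim (RInt (forward_integrand m2 t) t) F2 (locally (v2 t))) ->
  (forall t, J t -> Rabs (v1 t) <= K) -> (forall t, J t -> Rabs (v2 t) <= K) ->
  0 < eps -> is_approx_solution (Adiag l1 l2) I eps phi ->
  let x c1 c2 := fun t => mulv (Xdiag l1 l2 t0 t) (c1, c2) in
  exists c1 c2 : C,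
    filterlim (untwist l1 t0 (fun s => fst (phi s))) F1
      (locally (T := C_UniformSpace) c1) /\
    filterlim (untwist l2 t0 (fun s => snd (phi s))) F2
      (locally (T := C_UniformSpace) c2) /\
    is_solution (Adiag l1 l2) I (x c1 c2) /\
    within_dist I phi (x c1 c2) (K * eps) /\
    (filterlim (RInt (fun s => Re (l1 s)) t0) F1 (Rbar_locally p_infty) ->
     filterlim (RInt (fun s => Re (l2 s)) t0) F2 (Rbar_locally p_infty) ->
     is_unique_solution_within (Adiag l1 l2) I phi (K * eps) (x c1 c2)).
Proof.
intros J hI hl1 hl2 H0 HE1 HE2 hm1 hm2 Hm1 Hm2 Hv1 Hv2 HK1 HK2 Heps Hphi x.
assert (hc : is_convex J) by apply is_convex_interior.
assert (ho : forall s, J s -> locally s J) by apply interior_open.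
assert (hJ : forall t, J t -> I t).
{ intros t; now apply (interior_subset a b). }
assert (kl1 := continuous_on_subset I J l1 hJ hl1).
assert (kl2 := continuous_on_subset I J l2 hJ hl2).
destruct (is_approx_solution_components a b I l1 l2 eps phi hI Hphi)
  as (d1 & d2 & hd1 & hd2 & Hd).
destruct (untwist_limit J F1 S1 l1 (fun s => fst (phi s)) d1 m1 v1 eps t0)
  as (c1 & Hc1 & B1); auto; try (intros r Hr; now apply Hd).
destruct (untwist_limit J F2 S2 l2 (fun s => snd (phi s)) d2 m2 v2 eps t0)
  as (c2 & Hc2 & B2); auto; try (intros r Hr; now apply Hd).
exists c1, c2; split; [exact Hc1 | split; [exact Hc2 |]].
assert (Hsol : is_solution (Adiag l1 l2) I (x c1 c2)).
{ apply is_solution_Xdiag; auto; now apply is_convex_interval with a b. }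
assert (B1' : forall t, J t -> Cmod (Cminus (fst (phi t))
  (Cmult (Cexp (CRInt l1 t0 t)) c1)) <= K * eps).
{ intros t Ht; apply Rle_trans with (1 := B1 t Ht); rewrite Rmult_comm.
  apply Rmult_le_compat_r; [lra | auto]. }
assert (B2' : forall t, J t -> Cmod (Cminus (snd (phi t))
  (Cmult (Cexp (CRInt l2 t0 t)) c2)) <= K * eps).
{ intros t Ht; apply Rle_trans with (1 := B2 t Ht); rewrite Rmult_comm.
  apply Rmult_le_compat_r; [lra | auto]. }
assert (HphiC : forall t, I t ->
  filterlim (fun s => fst (phi s)) (within I (locally t))
    (locally (T := C_UniformSpace) (fst (phi t))) /\
  filterlim (fun s => snd (phi s)) (within I (locally t))
    (locally (T := C_UniformSpace) (snd (phi t)))).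
{ intros t Ht; destruct Hphi as (d & Hdp & _).
  apply is_derive_in_continuous with (1 := Hdp t Ht). }
assert (HxC : forall y, is_solution (Adiag l1 l2) I y -> forall t, I t ->
  filterlim (fun s => fst (y s)) (within I (locally t))
    (locally (T := C_UniformSpace) (fst (y t))) /\
  filterlim (fun s => snd (y s)) (within I (locally t))
    (locally (T := C_UniformSpace) (snd (y t)))).
{ intros y Hy t Ht; apply is_derive_in_continuous with (1 := Hy t Ht). }
assert (Hdist : within_dist I phi (x c1 c2) (K * eps)).
{ apply sup_on_le; intros t Ht; apply Rmax_lub.
  - apply (le_on_interval_of_interior a b I t0 t
      (fun s => Cmod (Cminus (fst (phi s)) (fst (x c1 c2 s))))); auto.
    + apply filterlim_Cmod_minus; [now apply HphiC | now apply HxC].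
    + intros s Hs; unfold x, Xdiag; rewrite mulv_diag2; now apply B1'.
  - apply (le_on_interval_of_interior a b I t0 t
      (fun s => Cmod (Cminus (snd (phi s)) (snd (x c1 c2 s))))); auto.
    + apply filterlim_Cmod_minus; [now apply HphiC | now apply HxC].
    + intros s Hs; unfold x, Xdiag; rewrite mulv_diag2; now apply B2'. }
split; [exact Hsol | split; [exact Hdist |]].
intros L1 L2; split; [exact Hsol | split; [exact Hdist |]].
intros y Hy Hyd.
assert (HyJ : forall s, J s ->
  is_derive (V := C_R_NormedModule) (fun r => fst (y r)) s
    (Cmult (l1 s) (fst (y s))) /\
  is_derive (V := C_R_NormedModule) (fun r => snd (y r)) s
    (Cmult (l2 s) (snd (y s)))).
{ intros s Hs.
  assert (HsI : locally s I) by (generalize (ho s Hs); apply filter_imp; auto).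
  assert (H := is_derive_in_interior I y s _ HsI (Hy s (hJ s Hs))).
  unfold Adiag in H; now rewrite mulv_diag2 in H. }
assert (Hyd' := proj1 (sup_on_le _ _ _) Hyd).
assert (E : forall s, J s -> y s = x c1 c2 s).
{ intros s Hs; unfold x, Xdiag; rewrite mulv_diag2.
  rewrite (surjective_pairing (y s)); simpl; apply f_equal2.
  - destruct HE1 as [HF1 HEv1 _ _].
    apply (homogeneous_solution_unique J F1 l1 (fun r => fst (phi r))
      (fun r => fst (y r)) c1 (K * eps) (K * eps) t0); auto.
    + generalize (HEv1 t0 H0); apply filter_imp; tauto.
    + intros r Hr; now apply HyJ.
    + intros r Hr; apply Rle_trans with (2 := Hyd' r (hJ r Hr)).
      apply (Rmax_l (Cmod (Cminus (fst (phi r)) (fst (y r))))).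
  - destruct HE2 as [HF2 HEv2 _ _].
    apply (homogeneous_solution_unique J F2 l2 (fun r => snd (phi r))
      (fun r => snd (y r)) c2 (K * eps) (K * eps) t0); auto.
    + generalize (HEv2 t0 H0); apply filter_imp; tauto.
    + intros r Hr; now apply HyJ.
    + intros r Hr; apply Rle_trans with (2 := Hyd' r (hJ r Hr)).
      apply (Rmax_r (Cmod (Cminus (fst (phi r)) (fst (y r))))). }
intros t Ht.
rewrite (surjective_pairing (y t)), (surjective_pairing (x c1 c2 t)).
(* Equality reaches the ends as the bound 0 on the modulus of a difference that is continuous
   relative to [I]. *)
apply f_equal2; apply Ceq_minus, Cmod_eq_0, Rle_antisym; try apply Cmod_ge_0.
- apply (le_on_interval_of_interior a b I t0 t
    (fun s => Cmod (Cminus (fst (y s)) (fst (x c1 c2 s))))); auto.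
  + apply filterlim_Cmod_minus; now apply HxC.
  + intros s Hs; rewrite (E s Hs), (proj1 (Ceq_minus _ _) eq_refl), Cmod_0.
    apply Rle_refl.
- apply (le_on_interval_of_interior a b I t0 t
    (fun s => Cmod (Cminus (snd (y s)) (snd (x c1 c2 s))))); auto.
  + apply filterlim_Cmod_minus; now apply HxC.
  + intros s Hs; rewrite (E s Hs), (proj1 (Ceq_minus _ _) eq_refl), Cmod_0.
    apply Rle_refl.
Qed.

Lemma filterlim_p_infty_le {F : (R -> Prop) -> Prop} {FF : Filter F}
    (f g : R -> R) :
  F (fun s => f s <= g s) -> filterlim f F (Rbar_locally p_infty) ->
  filterlim g F (Rbar_locally p_infty).
Proof.
intros Hle Hf P [M HM].
assert (HfM : F (fun s => M < f s)) by (apply Hf; now exists M).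
unfold filtermap; generalize (filter_and _ _ Hle HfM); apply filter_imp.
intros s [H1 H2]; apply HM; lra.
Qed.

Lemma filterlim_inv2_Xdiag (l1 l2 : R -> C) (t0 : R) (phi : R -> C2)
    (F : (R -> Prop) -> Prop) (FF : Filter F) (c1 c2 : C) :
  filterlim (untwist l1 t0 (fun s => fst (phi s))) F
    (locally (T := C_UniformSpace) c1) ->
  filterlim (untwist l2 t0 (fun s => snd (phi s))) F
    (locally (T := C_UniformSpace) c2) ->
  filterlim (fun t => mulv (inv2 (Xdiag l1 l2 t0 t)) (phi t)) F
    (locally (T := C2) (c1, c2)).
Proof.
intros H1 H2.
apply filterlim_ext with (fun t => (untwist l1 t0 (fun s => fst (phi s)) t,
  untwist l2 t0 (fun s => snd (phi s)) t)).
{ intros t; symmetry; apply mulv_inv2_Xdiag. }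
now apply filterlim_C2.
Qed.

Theorem theorem3p1
  (a b : Rbar) (hab : Rbar_lt a b)
  (I : R -> Prop) (hI : interval_with_ends a b I)
  (l1 l2 : R -> C)
  (hl1 : continuous_on (U := C_UniformSpace) I l1)
  (hl2 : continuous_on (U := C_UniformSpace) I l2)
  (t0 : R) (ht0 : Rbar_lt a t0 /\ Rbar_lt t0 b) :
  let A := Adiag l1 l2 in
  let X := Xdiag l1 l2 t0 in
  (* (i) *)
  ((forall t, I t -> ex_forward b (min_Re l1 l2) t) ->
   Rbar_lt (sup_on I (kappa11 b l1 l2)) p_infty ->
   let K11 := real (sup_on I (kappa11 b l1 l2)) in
   Ulam_stable A I /\ is_Ulam_constant A I K11 /\
   (filterlim (fun t => RInt (fun s => Rmin (Re (l1 s)) (Re (l2 s))) t0 t)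
      (Rbar_at_left b) (Rbar_locally p_infty) ->
    forall eps : R, 0 < eps ->
    forall phi : R -> C2, is_approx_solution A I eps phi ->
    exists c : C2,
      filterlim (fun t => mulv (inv2 (X t)) (phi t))
        (Rbar_at_left b) (locally c) /\
      is_unique_solution_within A I phi (K11 * eps) (fun t => mulv (X t) c)))
  /\
  (* (ii) *)
  ((forall t, I t -> ex_backward a (max_Re l1 l2) t) ->
   Rbar_lt (sup_on I (kappa12 a l1 l2)) p_infty ->
   let K12 := real (sup_on I (kappa12 a l1 l2)) in
   Ulam_stable A I /\ is_Ulam_constant A I K12 /\
   (filterlim (fun t => RInt (fun s => Rmin (- Re (l1 s)) (- Re (l2 s))) t t0)
      (Rbar_at_right a) (Rbar_locally p_infty) ->
    forall eps : R, 0 < eps ->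
    forall phi : R -> C2, is_approx_solution A I eps phi ->
    exists c : C2,
      filterlim (fun t => mulv (inv2 (X t)) (phi t))
        (Rbar_at_right a) (locally c) /\
      is_unique_solution_within A I phi (K12 * eps) (fun t => mulv (X t) c)))
  /\
  (* (iii) *)
  ((forall t, I t ->
      ex_forward b (fun s => Re (l1 s)) t /\
      ex_backward a (fun s => Re (l2 s)) t) ->
   Rbar_lt (sup_on I (kappa13 a b l1 l2)) p_infty ->
   let K13 := real (sup_on I (kappa13 a b l1 l2)) in
   Ulam_stable A I /\ is_Ulam_constant A I K13 /\
   (filterlim (fun t => RInt (fun s => Re (l1 s)) t0 t)
      (Rbar_at_left b) (Rbar_locally p_infty) ->
    filterlim (fun t => RInt (fun s => Re (l2 s)) t0 t)
      (Rbar_at_right a) (Rbar_locally p_infty) ->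
    forall eps : R, 0 < eps ->
    forall phi : R -> C2, is_approx_solution A I eps phi ->
    exists c1 c2 : C,
      filterlim (fun t => Cmult (fst (phi t)) (Cexp (Copp (CRInt l1 t0 t))))
        (Rbar_at_left b) (locally (T := C_UniformSpace) c1) /\
      filterlim (fun t => Cmult (snd (phi t)) (Cexp (CRInt l2 t t0)))
        (Rbar_at_right a) (locally (T := C_UniformSpace) c2) /\
      is_unique_solution_within A I phi (K13 * eps)
        (fun t => mulv (X t) (c1, c2)))).
Proof.
intros A X.
set (J := interior_of a b).
assert (H0 : J t0) by exact ht0.
assert (hc : is_convex J) by apply is_convex_interior.
assert (hJ : forall t, J t -> I t).
{ intros t; now apply (interior_subset a b). }
assert (kl1 := continuous_on_subset I J l1 hJ hl1).
assert (kl2 := continuous_on_subset I J l2 hJ hl2).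
assert (kR1 := continuous_on_Re J l1 kl1).
assert (kR2 := continuous_on_Re J l2 kl2).
assert (Lend := is_end_left a b t0 H0); assert (Rend := is_end_right a b t0 H0).
assert (LF : ProperFilter (Rbar_at_left b)) by apply Lend.
assert (RF : ProperFilter (Rbar_at_right a)) by apply Rend.
assert (exR : forall (m : R -> R) s t, continuous_on J m -> J s -> J t ->
  ex_RInt m s t).
{ intros m s t hm Hs Ht.
  now apply (ex_RInt_continuous_on (V := R_CompleteNormedModule) J). }
assert (Hmono : forall (m m' : R -> R) s t, continuous_on J m -> continuous_on J m' ->
  J s -> J t -> s <= t -> (forall x, m x <= m' x) ->
  RInt m s t <= RInt m' s t).
{ intros m m' s t hm hm' Hs Ht Hst Hle; apply RInt_le; auto. }
(* With reversed limits the larger function has the smaller oriented integral; this is how the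
   maximum becomes a lower comparison towards a. *)
assert (Hmono' : forall (m m' : R -> R) s t, continuous_on J m -> continuous_on J m' ->
  J s -> J t -> s >= t -> (forall x, m' x <= m x) ->
  RInt m s t <= RInt m' s t).
{ intros m m' s t hm hm' Hs Ht Hst Hle.
  rewrite <- (opp_RInt_swap m t s), <- (opp_RInt_swap m' t s) by auto.
  apply Ropp_le_contravar, Hmono; auto; now apply Rge_le. }
split; [| split].
- intros Hex Hsup K.
  assert (hm := continuous_on_min_Re J l1 l2 kl1 kl2).
  assert (HK : forall t, J t -> Rabs (kappa11 b l1 l2 t) <= K).
  { intros t Ht; rewrite Rabs_pos_eq; [apply le_real_sup_on; auto |].
    left; apply (forward_pos a b); auto. }
  assert (HK0 : 0 < K).
  { apply Rlt_le_trans with (kappa11 b l1 l2 t0).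
    - apply (forward_pos a b); auto.
    - apply le_real_sup_on; auto. }
  assert (M1 : forall x, min_Re l1 l2 x <= Re (l1 x)) by (intros; apply Rmin_l).
  assert (M2 : forall x, min_Re l1 l2 x <= Re (l2 x)) by (intros; apply Rmin_r).
  assert (core := fun eps phi => diagonal_Ulam a b I l1 l2 t0 K
    (Rbar_at_left b) (Rbar_at_left b) Rle Rle (min_Re l1 l2) (min_Re l1 l2)
    (kappa11 b l1 l2) (kappa11 b l1 l2) eps phi hI hl1 hl2 H0 Lend Lend hm hm
    (fun t s Ht Hs Hts => Hmono _ _ t s hm kR1 Ht Hs Hts M1)
    (fun t s Ht Hs Hts => Hmono _ _ t s hm kR2 Ht Hs Hts M2)
    (fun t Ht => filterlim_forward b _ t LF (Hex t (hJ t Ht)))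
    (fun t Ht => filterlim_forward b _ t LF (Hex t (hJ t Ht))) HK HK).
  assert (HU : is_Ulam_constant A I K).
  { split; [exact HK0 |]; intros eps Heps phi Hphi.
    destruct (core eps phi Heps Hphi) as (c1 & c2 & _ & _ & Hs & Hd & _).
    eexists; split; [exact Hs | exact Hd]. }
  split; [now exists K | split; [exact HU |]].
  intros Hlim eps Heps phi Hphi.
  destruct (core eps phi Heps Hphi) as (c1 & c2 & L1 & L2 & _ & _ & Huniq).
  exists (c1, c2); split.
  { apply filterlim_inv2_Xdiag; auto; apply LF. }
  (* Beyond t0 the integral of each real part dominates that of the minimum, so it inherits the
     divergence. *)
  apply Huniq; (eapply filterlim_p_infty_le; [| exact Hlim]);
    generalize (end_eventually _ _ _ Lend t0 H0); apply filter_imp;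
    intros s [Hs Hts]; now apply Hmono.
- intros Hex Hsup K.
  assert (hm := continuous_on_max_Re J l1 l2 kl1 kl2).
  assert (HK : forall t, J t -> Rabs (- kappa12 a l1 l2 t) <= K).
  { intros t Ht; rewrite Rabs_Ropp, Rabs_pos_eq; [apply le_real_sup_on; auto |].
    left; apply (backward_pos a b); auto. }
  assert (HK0 : 0 < K).
  { apply Rlt_le_trans with (kappa12 a l1 l2 t0).
    - apply (backward_pos a b); auto.
    - apply le_real_sup_on; auto. }
  assert (M1 : forall x, Re (l1 x) <= max_Re l1 l2 x) by (intros; apply Rmax_l).
  assert (M2 : forall x, Re (l2 x) <= max_Re l1 l2 x) by (intros; apply Rmax_r).
  assert (core := fun eps phi => diagonal_Ulam a b I l1 l2 t0 K
    (Rbar_at_right a) (Rbar_at_right a) Rge Rge (max_Re l1 l2) (max_Re l1 l2)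
    (fun t => - kappa12 a l1 l2 t) (fun t => - kappa12 a l1 l2 t) eps phi
    hI hl1 hl2 H0 Rend Rend hm hm
    (fun t s Ht Hs Hts => Hmono' _ _ t s hm kR1 Ht Hs Hts M1)
    (fun t s Ht Hs Hts => Hmono' _ _ t s hm kR2 Ht Hs Hts M2)
    (fun t Ht => filterlim_backward a b _ t hm Ht (Hex t (hJ t Ht)))
    (fun t Ht => filterlim_backward a b _ t hm Ht (Hex t (hJ t Ht))) HK HK).
  assert (HU : is_Ulam_constant A I K).
  { split; [exact HK0 |]; intros eps Heps phi Hphi.
    destruct (core eps phi Heps Hphi) as (c1 & c2 & _ & _ & Hs & Hd & _).
    eexists; split; [exact Hs | exact Hd]. }
  split; [now exists K | split; [exact HU |]].
  intros Hlim eps Heps phi Hphi.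
  destruct (core eps phi Heps Hphi) as (c1 & c2 & L1 & L2 & _ & _ & Huniq).
  exists (c1, c2); split.
  { apply filterlim_inv2_Xdiag; auto; apply RF. }
  (* As min(-x, -y) = - max(x, y), reversing the limits turns the hypothesis into divergence of
     int_{t0}^t of the maximum as t tends to a. *)
  assert (Hneg : forall s, RInt (fun s => Rmin (- Re (l1 s)) (- Re (l2 s))) s t0 =
    RInt (fun x => - max_Re l1 l2 x) s t0).
  { intros s; apply RInt_ext; intros x _; apply Rmin_opp_Rmax. }
  assert (Hlim' : filterlim (RInt (max_Re l1 l2) t0) (Rbar_at_right a)
    (Rbar_locally p_infty)).
  { eapply filterlim_p_infty_le; [| exact Hlim].
    generalize (end_eventually _ _ _ Rend t0 H0); apply filter_imp.
    intros s [Hs _]; rewrite Hneg; right.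
    rewrite <- (opp_RInt_swap (max_Re l1 l2) s t0) by auto.
    apply (RInt_opp (V := R_CompleteNormedModule) (max_Re l1 l2)); auto. }
  apply Huniq; (eapply filterlim_p_infty_le; [| exact Hlim']);
    generalize (end_eventually _ _ _ Rend t0 H0); apply filter_imp;
    intros s [Hs Hts]; now apply Hmono'.
- intros Hex Hsup K.
  assert (hf : forall t, J t -> 0 < forward b (fun s => Re (l1 s)) t).
  { intros t Ht; exact (forward_pos a b _ t kR1 Ht (proj1 (Hex t (hJ t Ht)))). }
  assert (hb : forall t, J t -> 0 < backward a (fun s => Re (l2 s)) t).
  { intros t Ht; exact (backward_pos a b _ t kR2 Ht (proj2 (Hex t (hJ t Ht)))). }
  assert (HKf : forall t, J t -> forward b (fun s => Re (l1 s)) t <= K).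
  { intros t Ht; apply Rle_trans with (kappa13 a b l1 l2 t).
    - apply Rmax_l.
    - apply le_real_sup_on; auto. }
  assert (HKb : forall t, J t -> backward a (fun s => Re (l2 s)) t <= K).
  { intros t Ht; apply Rle_trans with (kappa13 a b l1 l2 t).
    - apply Rmax_r.
    - apply le_real_sup_on; auto. }
  assert (HK1 : forall t, J t -> Rabs (forward b (fun s => Re (l1 s)) t) <= K).
  { intros t Ht; rewrite Rabs_pos_eq; [auto | left; auto]. }
  assert (HK2 : forall t, J t -> Rabs (- backward a (fun s => Re (l2 s)) t) <= K).
  { intros t Ht; rewrite Rabs_Ropp, Rabs_pos_eq; [auto | left; auto]. }
  assert (HK0 : 0 < K).
  { apply Rlt_le_trans with (1 := hf t0 H0); auto. }
  assert (core := fun eps phi => diagonal_Ulam a b I l1 l2 t0 K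
    (Rbar_at_left b) (Rbar_at_right a) Rle Rge
    (fun s => Re (l1 s)) (fun s => Re (l2 s))
    (forward b (fun s => Re (l1 s))) (fun t => - backward a (fun s => Re (l2 s)) t)
    eps phi hI hl1 hl2 H0 Lend Rend kR1 kR2
    (fun t s _ _ _ => Rle_refl _) (fun t s _ _ _ => Rle_refl _)
    (fun t Ht => filterlim_forward b _ t LF (proj1 (Hex t (hJ t Ht))))
    (fun t Ht => filterlim_backward a b _ t kR2 Ht (proj2 (Hex t (hJ t Ht))))
    HK1 HK2).
  assert (HU : is_Ulam_constant A I K).
  { split; [exact HK0 |]; intros eps Heps phi Hphi.
    destruct (core eps phi Heps Hphi) as (c1 & c2 & _ & _ & Hs & Hd & _).
    eexists; split; [exact Hs | exact Hd]. }
  split; [now exists K | split; [exact HU |]].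
  intros Hlim1 Hlim2 eps Heps phi Hphi.
  destruct (core eps phi Heps Hphi) as (c1 & c2 & L1 & L2 & _ & _ & Huniq).
  exists c1, c2; split; [exact L1 | split; [| now apply Huniq]].
  (* The statement uses exp(int_t^{t0} l2) and [untwist] uses exp(- int_{t0}^t l2); they agree for t
     in [J], hence eventually. *)
  eapply filterlim_ext_loc; [| exact L2].
  generalize (end_eventually _ _ _ Rend t0 H0); apply filter_imp.
  intros s [Hs _]; unfold untwist; do 2 apply f_equal.
  apply (opp_RInt_swap (V := C_R_CompleteNormedModule) l2 t0 s).
  now apply (ex_RInt_continuous_on (V := C_R_CompleteNormedModule) J).
Qed.
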